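(* Let $\mathcal{A}$ be a length abelian category with finitely many isomorphism classes of simple objects and enough projectives. Fix a total ordering $S_1,\ldots,S_n$ of representatives of the isomorphism classes of simple objects, and let $P_i$ and $\underline{\Delta}_i$ be the corresponding projective covers and proper standard objects. Then $\mathcal{A}$ is properly stratified with respect to the chosen order if and only if there exists a stability function $Z\colon K(\mathcal{A})\to\mathbb{C}$ on $\mathcal{A}$ such that (1) the proper standard objects $\underline{\Delta}_i$ are $Z$-stable with $\phi(\underline{\Delta}_i)<\phi(\underline{\Delta}_j)$ when $i<j$, and (2) for each $i=1,\ldots,n$, each Harder--Narasimhan factor of $P_i$ is a self-extension of some $\underline{\Delta}_j$ with $i\leq j$.
   Context: A length abelian category is one in which every object has finite length; no linearity over a field is assumed. $\mathrm{Filt}(\ldots)$ denotes the extension-closure of a collection of objects, i.e. the full subcategory of objects having a finite filtration whose factors are isomorphic to objects of the collection. $[A:S]$ is the multiplicity of the simple object $S$ in a Jordan--Hölder filtration of $A$, and $K(\mathcal{A})$ is the Grothendieck group. Let $P_i$ be the projective cover of $S_i$. The standard object $\Delta_i$ is the maximal length quotient of $P_i$ lying in $\mathrm{Filt}(S_j\mid j\leq i)$. The proper standard object $\underline{\Delta}_i$ is the maximal length quotient of $\Delta_i$ with $[\underline{\Delta}_i:S_i]=1$ (well-defined up to isomorphism). The category $\mathcal{A}$ is properly stratified with respect to the chosen order if $P_i\in\mathrm{Filt}(\underline{\Delta}_j\mid i\leq j)$ for each $i=1,\ldots,n$. A self-extension of $\underline{\Delta}_j$ means an (iterated) self-extension,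 i.e. an object of $\mathrm{Filt}(\underline{\Delta}_j)$. Let $\mathbb{H}=\{re^{i\pi\phi}\mid r>0,\ \phi\in(0,1]\}\subset\mathbb{C}$. A stability function on $\mathcal{A}$ is a group homomorphism $Z\colon K(\mathcal{A})\to\mathbb{C}$ such that $Z(A):=Z([A])\in\mathbb{H}$ for every nonzero $A\in\mathcal{A}$. The phase $\phi(A)\in(0,1]$ of a nonzero object $A$ is determined by $Z(A)\in\mathbb{R}_{>0}e^{i\pi\phi(A)}$. A nonzero object $A$ is $Z$-semistable if $\phi(A')\leq\phi(A)$ for every nonzero proper subobject $A'\subset A$, and $Z$-stable if the inequality is always strict. Since $\mathcal{A}$ is a length category, every nonzero object $A$ has a unique Harder--Narasimhan filtration $0=A_0\subset A_1\subset\cdots\subset A_d=A$ in which each $A_l/A_{l-1}$ is nonzero and $Z$-semistable of phase $\phi_l$, with $\phi_1>\phi_2>\cdots>\phi_d$; the quotients $A_l/A_{l-1}$ are the Harder--Narasimhan factors of $A$. *)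

(* Defs.v *)
From Stdlib Require List.
From HB Require Import structures.
From mathcomp Require Import all_boot all_order all_algebra.
From mathcomp Require Import generic_quotient ring_quotient complex.
From mathcomp Require Import all_classical all_reals all_analysis.
From mathcomp Require Import freeg.

Set Implicit Arguments.
Unset Strict Implicit.
Unset Printing Implicit Defensive.

Import Order.TTheory GRing.Theory Num.Theory.

Local Open Scope ring_scope.
Local Open Scope quotient_scope.
Local Open Scope classical_set_scope.

Declare Scope cat_scope.
Delimit Scope cat_scope with cat.

Record preadditive := Preadditive {
  obj :> Type;
  mor : obj -> obj -> zmodType;
  idm : forall A, mor A A;
  mcomp : forall A B D, mor B D -> mor A B -> mor A D;
  mcompA : forall A B D E (h : mor D E) (g : mor B D) (f : mor A B),
    mcomp h (mcomp g f) = mcomp (mcomp h g) f;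
  mcomp1m : forall A B (f : mor A B), mcomp (idm B) f = f;
  mcompm1 : forall A B (f : mor A B), mcomp f (idm A) = f;
  mcompDl : forall A B D (g1 g2 : mor B D) (f : mor A B),
    mcomp (g1 + g2) f = mcomp g1 f + mcomp g2 f;
  mcompDr : forall A B D (g : mor B D) (f1 f2 : mor A B),
    mcomp g (f1 + f2) = mcomp g f1 + mcomp g f2 }.

Arguments mor {p} _ _.
Arguments idm {p} A.
Arguments mcomp {p A B D} _ _.

Notation "g \o f" := (mcomp g f) : cat_scope.
Local Open Scope cat_scope.

Definition is_zero (C : preadditive) (A : C) : Prop :=
  forall X : C, (forall f : mor X A, f = 0) /\ (forall f : mor A X, f = 0).

Definition is_mono (C : preadditive) (A B : C) (f : mor A B) : Prop :=
  forall (X : C) (u v : mor X A), f \o u = f \o v -> u = v.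

Definition is_epi (C : preadditive) (A B : C) (f : mor A B) : Prop :=
  forall (X : C) (u v : mor B X), u \o f = v \o f -> u = v.

Definition is_iso (C : preadditive) (A B : C) (f : mor A B) : Prop :=
  exists g : mor B A, g \o f = idm A /\ f \o g = idm B.

Definition isomorphic (C : preadditive) (A B : C) : Prop :=
  exists f : mor A B, is_iso f.

Definition is_kernel (C : preadditive) (K A B : C)
    (k : mor K A) (f : mor A B) : Prop :=
  f \o k = 0 /\
  forall (X : C) (h : mor X A), f \o h = 0 -> exists! u : mor X K, k \o u = h.

Definition is_cokernel (C : preadditive) (A B Q : C)
    (q : mor B Q) (f : mor A B) : Prop :=
  q \o f = 0 /\
  forall (X : C) (h : mor B X), h \o f = 0 -> exists! u : mor Q X, u \o q = h.

Definition is_biproduct (C : preadditive) (A B D : C)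
    (i1 : mor A D) (i2 : mor B D) (p1 : mor D A) (p2 : mor D B) : Prop :=
  [/\ p1 \o i1 = idm A, p2 \o i2 = idm B, p1 \o i2 = 0, p2 \o i1 = 0
    & (i1 \o p1) + (i2 \o p2) = idm D].

Record abelian_category := AbelianCategory {
  abelian_preadditive :> preadditive;
  has_zero_object : exists A : abelian_preadditive, is_zero A;
  has_biproducts : forall A B : abelian_preadditive,
    exists (D : abelian_preadditive) (i1 : mor A D) (i2 : mor B D)
           (p1 : mor D A) (p2 : mor D B), is_biproduct i1 i2 p1 p2;
  has_kernels : forall (A B : abelian_preadditive) (f : mor A B),
    exists (K : abelian_preadditive) (k : mor K A), is_kernel k f;
  has_cokernels : forall (A B : abelian_preadditive) (f : mor A B),
    exists (Q : abelian_preadditive) (q : mor B Q), is_cokernel q f;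
  mono_normal : forall (A B : abelian_preadditive) (f : mor A B), is_mono f ->
    exists (D : abelian_preadditive) (g : mor B D), is_kernel f g;
  epi_normal : forall (A B : abelian_preadditive) (f : mor A B), is_epi f ->
    exists (D : abelian_preadditive) (g : mor D A), is_cokernel f g }.

Definition short_exact (C : preadditive) (A B D : C)
    (f : mor A B) (g : mor B D) : Prop :=
  is_kernel f g /\ is_cokernel g f.

Definition simple_object (C : preadditive) (S : C) : Prop :=
  ~ is_zero S /\
  forall (A : C) (f : mor A S), is_mono f -> is_zero A \/ is_iso f.

(* [filtration A Fs]: there are subobjects 0 = A_0 <= ... <= A_d = A whose
   l-th factor A_l/A_{l-1} is isomorphic to the l-th entry of [Fs]. *)
Inductive filtration (C : preadditive) : C -> seq C -> Prop :=
| filtration_nil (A : C) : is_zero A -> filtration A [::]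
| filtration_rcons (A' A F : C) (Fs : seq C) (f : mor A' A) (g : mor A F) :
    filtration A' Fs -> short_exact f g -> filtration A (rcons Fs F).

Definition Filt (C : preadditive) (Q : C -> Prop) (A : C) : Prop :=
  exists2 Fs : seq C, filtration A Fs &
    List.Forall (fun F => exists2 X, Q X & isomorphic F X) Fs.

Definition jordan_holder (C : preadditive) (A : C) (Fs : seq C) : Prop :=
  filtration A Fs /\ List.Forall (@simple_object C) Fs.

Definition length_category (C : preadditive) : Prop :=
  forall A : C, exists Fs : seq C, jordan_holder A Fs.

(* In [obj_length] and [mult] the value does not depend on the chosen filtration,
   by the Jordan-Hoelder theorem; it is junk if there is none. *)
Definition obj_length (C : preadditive) (A : C) : nat :=
  xget 0%N [set size Fs | Fs in jordan_holder A].

Definition mult (C : preadditive) (A S : C) : nat :=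
  xget 0%N [set count (fun F => `[< isomorphic F S >]) Fs
           | Fs in jordan_holder A].

Definition projective (C : preadditive) (P : C) : Prop :=
  forall (A B : C) (g : mor A B) (h : mor P B), is_epi g ->
    exists u : mor P A, g \o u = h.

Definition enough_projectives (C : preadditive) : Prop :=
  forall A : C, exists (P : C) (p : mor P A), projective P /\ is_epi p.

Definition essential_epi (C : preadditive) (A B : C) (p : mor A B) : Prop :=
  is_epi p /\ forall (X : C) (h : mor X A), is_epi (p \o h) -> is_epi h.

Definition projective_cover (C : preadditive) (P A : C) : Prop :=
  projective P /\ exists p : mor P A, essential_epi p.

Definition quotient_of (C : preadditive) (A B : C) : Prop :=
  exists q : mor A B, is_epi q.

Definition max_length_quotient (C : preadditive) (Q : C -> Prop) (A B : C) :
    Prop :=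
  [/\ quotient_of A B, Q B &
      forall B' : C, quotient_of A B' -> Q B' -> (obj_length B' <= obj_length B)%N].

Definition simple_representatives (C : preadditive) (n : nat) (S : 'I_n -> C) :
    Prop :=
  [/\ forall i, simple_object (S i),
      forall i j, isomorphic (S i) (S j) -> i = j
    & forall X : C, simple_object X -> exists i, isomorphic X (S i)].

Definition standard_object (C : preadditive) (n : nat) (S P : 'I_n -> C) (i : 'I_n)
    (D : C) : Prop :=
  max_length_quotient (Filt (fun X => exists2 j : 'I_n, (j <= i)%N & X = S j)) (P i) D.

Definition proper_standard_object (C : preadditive) (n : nat) (S D : 'I_n -> C)
    (i : 'I_n) (E : C) : Prop :=
  max_length_quotient (fun X => mult X (S i) = 1%N) (D i) E.

(* [P] and [E] are the projective covers and the proper standard objects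
   attached to the ordered family of simple objects under consideration. *)
Definition properly_stratified (C : preadditive) (n : nat) (P E : 'I_n -> C) :
    Prop :=
  forall i : 'I_n, Filt (fun X => exists2 j : 'I_n, (i <= j)%N & X = E j) (P i).

Definition free_on_objects (C : preadditive) : zmodType :=
  {freeg {classic C} / int}.

Definition obj_gen (C : preadditive) (A : C) : free_on_objects C :=
  << (A : {classic C}) >>.

Definition K0_relations (C : preadditive) : {pred free_on_objects C} :=
  [pred x | `[< forall G : {pred free_on_objects C}, zmod_closed G ->
    (forall (A B D : C) (f : mor A B) (g : mor B D), short_exact f g ->
       obj_gen B - obj_gen A - obj_gen D \in G) -> x \in G >] ].

Fact K0_relations_zmod_closed (C : preadditive) : zmod_closed (@K0_relations C).
Proof.
split=> [|x y /asboolP xK /asboolP yK]; apply/asboolP => G clG ses.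
  by case: clG.
by case: (clG) => _; apply; [apply: xK|apply: yK].
Qed.

HB.instance Definition _ (C : preadditive) :=
  GRing.isZmodClosed.Build (free_on_objects C) (@K0_relations C)
    (K0_relations_zmod_closed C).

Definition K0 (C : preadditive) : zmodType := Quotient.quot (@K0_relations C).

Definition K0_class (C : preadditive) (A : C) : K0 C := \pi_(K0 C) (obj_gen A).

Definition expipi (R : realType) (t : R) : R[i] :=
  Complex (cos (pi * t)) (sin (pi * t)).

Definition has_phase (R : realType) (z : R[i]) (t : R) : Prop :=
  0 < t <= 1 /\ exists2 r : R, 0 < r & z = (r%:C)%C * expipi t.

Definition semiclosed_upper_half_plane (R : realType) : set R[i] :=
  [set z | exists t : R, has_phase z t].

Section Stability.
Context (R : realType) (C : preadditive).
Implicit Types (Z : {additive K0 C -> R[i]}) (A F : C) (Fs : seq C).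

Definition stability_function Z : Prop :=
  forall A, ~ is_zero A -> semiclosed_upper_half_plane (Z (K0_class A)).

(* The phase is unique when it exists; otherwise this is junk. *)
Definition phase Z A : R := xget 0 [set t | has_phase (Z (K0_class A)) t].

Definition semistable Z A : Prop :=
  ~ is_zero A /\
  forall (A' : C) (f : mor A' A), is_mono f -> ~ is_zero A' -> ~ is_iso f ->
    phase Z A' <= phase Z A.

Definition stable Z A : Prop :=
  ~ is_zero A /\
  forall (A' : C) (f : mor A' A), is_mono f -> ~ is_zero A' -> ~ is_iso f ->
    phase Z A' < phase Z A.

Definition harder_narasimhan Z A Fs : Prop :=
  [/\ filtration A Fs, List.Forall (semistable Z) Fs
    & sorted (fun F G => phase Z G < phase Z F) Fs].

Definition hn_factor Z A F : Prop :=
  exists2 Fs, harder_narasimhan Z A Fs & List.In F Fs.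

End Stability.

(* Main.v *)
Require Import Defs.
From HB Require Import structures.
From mathcomp Require Import all_boot all_order all_algebra.
From mathcomp Require Import generic_quotient ring_quotient complex.
From mathcomp Require Import all_classical all_reals all_analysis.
From mathcomp Require Import freeg.
From mathcomp Require Import ring lra.

(* If P_i has a filtration with factors E_j, j >= i, its top factor must be E_i, since
   P_i has simple top S_i; hence the kernel of P_i -> E_i is filtered by such E_j. As
   Hom(E_j, E_k) = 0 for j > k, this gives Ext^1(E_j, E_k) = 0 for j > k, so the
   factors can be sorted with larger indices lower in the filtration and then grouped
   into self-extensions. Put Z(S_k) = - M^k + i with M larger than the lengths of all
   E_j. Phases are then dominated by the largest index that occurs, every proper
   subobject of E_j involves only S_k with k < j, so E_j is stable, the phases of the
   E_j increase with j, and the sorted filtration is the Harder-Narasimhan filtration,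
   which is unique. The converse only needs the existence of Harder-Narasimhan
   filtrations. *)

Set Implicit Arguments.
Unset Strict Implicit.
Unset Printing Implicit Defensive.

Import Order.TTheory GRing.Theory Num.Theory.

Local Open Scope ring_scope.
Local Open Scope quotient_scope.
Local Open Scope cat_scope.

(** * Abelian categories *)

Section Preadditive.
Context (C : preadditive).
Implicit Types A B D X : C.

Lemma mcomp0m A B D (f : mor A B) : (0 : mor B D) \o f = 0.
Proof. by apply: (addrI (0 \o f)); rewrite -mcompDl !addr0. Qed.

Lemma mcompm0 A B D (g : mor B D) : g \o (0 : mor A B) = 0.
Proof. by apply: (addrI (g \o 0)); rewrite -mcompDr !addr0. Qed.

Lemma mcompNm A B D (g : mor B D) (f : mor A B) : (- g) \o f = - (g \o f).
Proof. by apply: (addrI (g \o f)); rewrite -mcompDl !subrr mcomp0m. Qed.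

Lemma mcompmN A B D (g : mor B D) (f : mor A B) : g \o (- f) = - (g \o f).
Proof. by apply: (addrI (g \o f)); rewrite -mcompDr !subrr mcompm0. Qed.

Lemma mcompBl A B D (g1 g2 : mor B D) (f : mor A B) :
  (g1 - g2) \o f = (g1 \o f) - (g2 \o f).
Proof. by rewrite mcompDl mcompNm. Qed.

Lemma mcompBr A B D (g : mor B D) (f1 f2 : mor A B) :
  g \o (f1 - f2) = (g \o f1) - (g \o f2).
Proof. by rewrite mcompDr mcompmN. Qed.

Lemma mor_to_zero A X (f : mor X A) : is_zero A -> f = 0.
Proof. by move=> /(_ X)[f0 _]; apply: f0. Qed.

Lemma mor_from_zero A X (f : mor A X) : is_zero A -> f = 0.
Proof. by move=> /(_ X)[_ f0]; apply: f0. Qed.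

Lemma is_zeroP A : is_zero A <-> idm A = 0.
Proof.
split=> [zA|A0 X]; first exact: mor_to_zero.
by split=> f; [rewrite -[f]mcomp1m A0 mcomp0m|rewrite -[f]mcompm1 A0 mcompm0].
Qed.

Lemma is_monoP A B (f : mor A B) :
  is_mono f <-> forall X (u : mor X A), f \o u = 0 -> u = 0.
Proof.
split=> [mf X u fu0|mf X u v fuv]; first by apply: mf; rewrite fu0 mcompm0.
by apply/eqP; rewrite -subr_eq0; apply/eqP/mf; rewrite mcompBr fuv subrr.
Qed.

Lemma is_epiP A B (f : mor A B) :
  is_epi f <-> forall X (u : mor B X), u \o f = 0 -> u = 0.
Proof.
split=> [mf X u fu0|mf X u v fuv]; first by apply: mf; rewrite fu0 mcomp0m.
by apply/eqP; rewrite -subr_eq0; apply/eqP/mf; rewrite mcompBl fuv subrr.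
Qed.

Lemma mono_comp A B D (g : mor B D) (f : mor A B) :
  is_mono g -> is_mono f -> is_mono (g \o f).
Proof. by move=> mg mf X u v; rewrite -!mcompA => /mg/mf. Qed.

Lemma epi_comp A B D (g : mor B D) (f : mor A B) :
  is_epi g -> is_epi f -> is_epi (g \o f).
Proof. by move=> eg ef X u v; rewrite !mcompA => /ef/eg. Qed.

Lemma mono_of_comp A B D (g : mor B D) (f : mor A B) :
  is_mono (g \o f) -> is_mono f.
Proof. by move=> m X u v fuv; apply: m; rewrite -!mcompA fuv. Qed.

Lemma epi_of_comp A B D (g : mor B D) (f : mor A B) :
  is_epi (g \o f) -> is_epi g.
Proof. by move=> e X u v fuv; apply: e; rewrite !mcompA fuv. Qed.

Lemma iso_mono A B (f : mor A B) : is_iso f -> is_mono f.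
Proof.
by case=> g [gf _] X u v e; rewrite -[u]mcomp1m -[v]mcomp1m -gf -!mcompA e.
Qed.

Lemma iso_epi A B (f : mor A B) : is_iso f -> is_epi f.
Proof.
by case=> g [_ fg] X u v e; rewrite -[u]mcompm1 -[v]mcompm1 -fg !mcompA e.
Qed.

Lemma iso_idm A : is_iso (idm A).
Proof. by exists (idm A); rewrite mcomp1m. Qed.

Lemma iso_comp A B D (g : mor B D) (f : mor A B) :
  is_iso g -> is_iso f -> is_iso (g \o f).
Proof.
case=> g' [g'g gg'] [f' [f'f ff']]; exists (f' \o g'); split.
  by rewrite -mcompA (mcompA g') g'g mcomp1m.
by rewrite -mcompA (mcompA f) ff' mcomp1m.
Qed.

Lemma isomorphic_refl A : isomorphic A A.
Proof. by exists (idm A); apply: iso_idm. Qed.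

Lemma isomorphic_sym A B : isomorphic A B -> isomorphic B A.
Proof. by case=> f [g [gf fg]]; exists g, f. Qed.

Lemma isomorphic_trans A B D : isomorphic A B -> isomorphic B D -> isomorphic A D.
Proof. by case=> f ? [g ?]; exists (g \o f); apply: iso_comp. Qed.

Lemma mono_to_zero A B (f : mor A B) : is_mono f -> is_zero B -> is_zero A.
Proof.
by move=> mf zB; apply/is_zeroP/mf; rewrite mcompm0; apply: mor_to_zero.
Qed.

Lemma epi_from_zero A B (f : mor A B) : is_epi f -> is_zero A -> is_zero B.
Proof.
by move=> ef zA; apply/is_zeroP/ef; rewrite mcomp0m; apply: mor_from_zero.
Qed.

Lemma isomorphic_zero A B : isomorphic A B -> is_zero A -> is_zero B.
Proof. by case=> f /iso_epi; apply: epi_from_zero. Qed.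

Lemma is_kernelP K A B (k : mor K A) (f : mor A B) : is_mono k -> f \o k = 0 ->
  (forall X (h : mor X A), f \o h = 0 -> exists u, k \o u = h) -> is_kernel k f.
Proof.
move=> mk fk0 ex; split=> // X h /ex[u ku]; exists u; split=> // v kv.
by apply: mk; rewrite ku kv.
Qed.

Lemma kernel_mono K A B (k : mor K A) (f : mor A B) : is_kernel k f -> is_mono k.
Proof.
case=> fk0 ex; apply/is_monoP => X u ku0.
have [|w [_ uniq_w]] := ex X 0; first by rewrite mcompm0.
by rewrite -(uniq_w u ku0) (uniq_w 0) ?mcompm0.
Qed.

Lemma kernel_lift K A B X (k : mor K A) (f : mor A B) (h : mor X A) :
  is_kernel k f -> f \o h = 0 -> exists u, k \o u = h.
Proof. by case=> _ ex /ex[u [ku _]]; exists u. Qed.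

Lemma kernel_isomorphic K K' A B B' (k : mor K A) (k' : mor K' A)
    (f : mor A B) (f' : mor A B') :
  is_kernel k f -> is_kernel k' f' -> f \o k' = 0 -> f' \o k = 0 ->
  isomorphic K K'.
Proof.
move=> kf kf' /(kernel_lift kf)[u ku] /(kernel_lift kf')[v kv].
exists v, u; split.
  by apply: (kernel_mono kf); rewrite mcompA ku kv mcompm1.
by apply: (kernel_mono kf'); rewrite mcompA kv ku mcompm1.
Qed.

End Preadditive.

(** Left transparent, like [op_abelian], so that a statement about the opposite category unfolds by
    conversion to its dual; the results on cokernels and quotients are obtained this way. *)
Definition op_preadditive (C : preadditive) : preadditive.
Proof.
apply: (@Preadditive (obj C) (fun A B => mor B A) (fun A => idm A)
  (fun A B D g f => f \o g)) => *.
- by rewrite mcompA.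
- by rewrite mcompm1.
- by rewrite mcomp1m.
- by rewrite mcompDr.
- by rewrite mcompDl.
Defined.

Definition op_abelian (C : abelian_category) : abelian_category.
Proof.
apply: (@AbelianCategory (op_preadditive C)).
- by have [A zA] := has_zero_object C; exists A => X; have [? ?] := zA X.
- move=> A B; have [D [i1 [i2 [p1 [p2 [? ? ? ? ?]]]]]] := has_biproducts A B.
  by exists D, p1, p2, i1, i2; split.
- by move=> A B f; apply: (@has_cokernels C B A f).
- by move=> A B f; apply: (@has_kernels C B A f).
- by move=> A B f /(@epi_normal C B A f).
- by move=> A B f /(@mono_normal C B A f).
Defined.

Section Abelian.
Context (C : abelian_category).
Implicit Types A B D X : C.

Lemma mono_epi_iso A B (f : mor A B) : is_mono f -> is_epi f -> is_iso f.
Proof.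
move=> mf ef; have [D [g kfg]] := mono_normal mf.
have g0 : g = 0 by apply: ef; rewrite mcomp0m; case: kfg.
have [|u fu] := kernel_lift (h := idm B) kfg; first by rewrite mcompm1.
exists u; split=> //; apply: mf.
by rewrite mcompA fu mcomp1m mcompm1.
Qed.

(** The mono [f] is the kernel of some [g], and [g] factors through [q]; hence [g] kills whatever
    [q] kills. *)
Lemma mono_kernel_cokernel A B Q (f : mor A B) (q : mor B Q) :
  is_mono f -> is_cokernel q f -> is_kernel f q.
Proof.
move=> mf [qf0 qU]; have [D [g kfg]] := mono_normal mf.
have [g' [g'q _]] := qU _ g (proj1 kfg).
apply: is_kernelP => // X h qh0; apply: (kernel_lift kfg).
by rewrite -g'q -mcompA qh0 mcompm0.
Qed.

(** The image is the kernel of the cokernel of [f]. If [h] kills [e], then [f] factors through the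
    subobject [ker h] of [I]; this subobject is itself the kernel of some [g], and [g] kills [f],
    hence kills [m]. So [ker h] is all of [I]. *)
Lemma image_factorization A B (f : mor A B) :
  exists I (e : mor A I) (m : mor I B), [/\ is_epi e, is_mono m & m \o e = f].
Proof.
have [Q [q [qf0 qU]]] := has_cokernels f; have [I [m km]] := has_kernels q.
have [e me] := kernel_lift km qf0; have mm := kernel_mono km.
exists I, e, m; split=> //; apply/is_epiP => X h he0.
have [K [k kk]] := has_kernels h; have [e' ke] := kernel_lift kk he0.
have [D [g kg]] := mono_normal (mono_comp mm (kernel_mono kk)).
have gf0 : g \o f = 0.
  by rewrite -me -ke (mcompA m) mcompA (proj1 kg) mcomp0m.
have [g' [g'q _]] := qU _ _ gf0.
have gm0 : g \o m = 0 by rewrite -g'q -mcompA (proj1 km) mcompm0.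
have [t mkt] := kernel_lift kg gm0.
have kt : k \o t = idm I by apply: mm; rewrite mcompm1 mcompA.
by rewrite -[h]mcompm1 -kt mcompA (proj1 kk) mcomp0m.
Qed.

End Abelian.

Lemma cokernel_epi (C : preadditive) (A B Q : C) (q : mor B Q) (f : mor A B) :
  is_cokernel q f -> is_epi q.
Proof. exact: (@kernel_mono (op_preadditive C) Q B A q f). Qed.

Lemma cokernel_desc (C : preadditive) (A B Q X : C) (q : mor B Q) (f : mor A B)
    (h : mor B X) : is_cokernel q f -> h \o f = 0 -> exists u, u \o q = h.
Proof. exact: (@kernel_lift (op_preadditive C) Q B A X q f h). Qed.

Lemma epi_cokernel_kernel (C : abelian_category) (K A B : C) (f : mor A B)
    (k : mor K A) : is_epi f -> is_kernel k f -> is_cokernel f k.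
Proof. exact: (@mono_kernel_cokernel (op_abelian C) B A K f k). Qed.

(** * Short exact sequences, pullbacks, preimages and quotients *)

Section ShortExact.
Context (C : preadditive) (A B D : C) (f : mor A B) (g : mor B D).
Hypothesis fg : short_exact f g.

Lemma ses_mono : is_mono f. Proof. exact: kernel_mono (proj1 fg). Qed.
Lemma ses_epi : is_epi g. Proof. exact: cokernel_epi (proj2 fg). Qed.
Lemma ses_comp : g \o f = 0. Proof. by case: fg => -[]. Qed.

Lemma ses_lift X (h : mor X B) : g \o h = 0 -> exists u, f \o u = h.
Proof. exact: kernel_lift (proj1 fg). Qed.

Lemma ses_desc X (h : mor B X) : h \o f = 0 -> exists u, u \o g = h.
Proof. exact: cokernel_desc (proj2 fg). Qed.

Lemma ses_zero_epi : is_zero D -> is_iso f.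
Proof.
move=> zD; have [|u fu] := @ses_lift _ (idm B).
  exact: mor_to_zero.
exists u; split=> //; apply: ses_mono.
by rewrite mcompA fu mcomp1m mcompm1.
Qed.

Lemma ses_zero_mono : is_zero A -> is_iso g.
Proof.
move=> zD; have [|u fu] := @ses_desc _ (idm B).
  exact: mor_from_zero.
exists u; split=> //; apply: ses_epi.
by rewrite -mcompA fu mcomp1m mcompm1.
Qed.

Lemma ses_iso_zero_mono : is_iso g -> is_zero A.
Proof.
move=> /iso_mono mg; have f0 : f = 0 by apply: mg; rewrite ses_comp mcompm0.
by apply/is_zeroP/ses_mono; rewrite f0 !mcomp0m.
Qed.

Lemma ses_iso_zero_epi : is_iso f -> is_zero D.
Proof.
move=> /iso_epi ef; have g0 : g = 0 by apply: ef; rewrite ses_comp mcomp0m.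
by apply/is_zeroP/ses_epi; rewrite g0 !mcompm0.
Qed.

End ShortExact.

Section AbelianSES.
Context (C : abelian_category).
Implicit Types A B D X : C.

Lemma ses_of_kernel A B D (f : mor A B) (g : mor B D) :
  is_epi g -> is_kernel f g -> short_exact f g.
Proof. by move=> eg kf; split=> //; apply: epi_cokernel_kernel. Qed.

Lemma ses_of_mono A B (f : mor A B) : is_mono f ->
  exists Q (q : mor B Q), short_exact f q.
Proof.
move=> mf; have [Q [q cq]] := has_cokernels f; exists Q, q; split=> //.
exact: mono_kernel_cokernel.
Qed.

Lemma ses_of_epi A B (f : mor A B) : is_epi f ->
  exists K (k : mor K A), short_exact k f.
Proof.
move=> mf; have [K [k kk]] := has_kernels f; exists K, k.
exact: ses_of_kernel.
Qed.

Lemma ses_iso_middle A B D X (f : mor A B) (g : mor B D) (u : mor B X) (v : mor X B) :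
  short_exact f g -> u \o v = idm X -> v \o u = idm B -> 
  short_exact (u \o f) (g \o v).
Proof.
move=> fg uv vu; have iu : is_iso u by exists v. 
have iv : is_iso v by exists u.
apply: ses_of_kernel; first exact: epi_comp (ses_epi fg) (iso_epi iv).
apply: is_kernelP.
- exact: mono_comp (iso_mono iu) (ses_mono fg).
- by rewrite -mcompA (mcompA v) vu mcomp1m (ses_comp fg).
- move=> Y h; rewrite -mcompA => /(ses_lift fg)[w fw]; exists w.
  by rewrite -mcompA fw mcompA uv mcomp1m.
Qed.

Lemma ses_iso_quotient A B D X (f : mor A B) (g : mor B D) (u : mor D X) :
  short_exact f g -> is_iso u -> short_exact f (u \o g).
Proof.
move=> fg iu; apply: ses_of_kernel; first exact: epi_comp (iso_epi iu) (ses_epi fg).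
apply: is_kernelP; first exact: ses_mono fg.
  by rewrite -mcompA (ses_comp fg) mcompm0.
by move=> Y h; rewrite -mcompA => uh; apply: (ses_lift fg); apply: (iso_mono iu);
  rewrite uh mcompm0.
Qed.

(** The pullback is the kernel of [d], the difference of the two maps on the biproduct. A morphism
    that kills [b] yields one on the biproduct that factors through [d]; restricting the factor
    along [i1] shows that it vanishes, because [f] is epi. *)
Lemma pullback_epi A B D (f : mor A D) (g : mor B D) : is_epi f ->
  exists X (a : mor X A) (b : mor X B), f \o a = g \o b /\ is_epi b.
Proof.
move=> ef.
have [S [i1 [i2 [p1 [p2 [pi1 pi2 pi12 pi21 _]]]]]] := has_biproducts A B.
pose d := (f \o p1) - (g \o p2).
have di1 : d \o i1 = f.
  by rewrite mcompBl -!mcompA pi1 pi21 mcompm0 mcompm1 subr0.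
have ed : is_epi d by apply: (@epi_of_comp _ _ _ _ d i1); rewrite di1.
have [X [k kd]] := ses_of_epi ed.
exists X, (p1 \o k), (p2 \o k); split.
  by apply/eqP; rewrite -subr_eq0 !mcompA -mcompBl (ses_comp kd).
apply/is_epiP => T h; rewrite mcompA => /(ses_desc kd)[h' h'd].
have h'0 : h' = 0.
  by apply: ef; rewrite -{1}di1 mcompA h'd -mcompA pi21 mcompm0 mcomp0m.
by rewrite -[h]mcompm1 -pi2 mcompA -h'd h'0 !mcomp0m.
Qed.

(** [B] is the preimage in [A] of the subobject [K] of [F], constructed as the kernel of
    [c \o g]. *)
Lemma ses_preimage A' A F K Q (f : mor A' A) (g : mor A F) (k : mor K F)
    (c : mor F Q) : short_exact f g -> short_exact k c ->
  exists B (b : mor B A) (f' : mor A' B) (g' : mor B K),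
    [/\ short_exact f' g', short_exact b (c \o g), b \o f' = f & g \o b = k \o g'].
Proof.
move=> fg kc; have ecg := epi_comp (ses_epi kc) (ses_epi fg).
have [B [b bs]] := ses_of_epi ecg; have mb := ses_mono bs.
have [|f' bf'] := ses_lift (h := f) bs; first by rewrite -mcompA (ses_comp fg) mcompm0.
have [|g' kg'] := ses_lift (h := g \o b) kc; first by rewrite mcompA (ses_comp bs).
(* The pullback is used only to see that [g'] is epi: its projection [x] onto [K] is epi and factors
   through [g']. *)
have [X [a [x [ax ex]]]] := pullback_epi k (ses_epi fg).
have [|w bw] := ses_lift (h := a) bs.
  by rewrite -mcompA ax mcompA (ses_comp kc) mcomp0m.
exists B, b, f', g'; split=> //; apply: ses_of_kernel.
  apply: (@epi_of_comp _ _ _ _ g' w); suff -> : g' \o w = x by [].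
  by apply: (ses_mono kc); rewrite mcompA kg' -mcompA bw.
apply: is_kernelP.
- by apply: (@mono_of_comp _ _ _ _ b); rewrite bf'; apply: ses_mono fg.
- by apply: (ses_mono kc); rewrite mcompA kg' -mcompA bf' (ses_comp fg) mcompm0.
- move=> Y h g'h0; have [|u fu] := ses_lift (h := b \o h) fg.
    by rewrite mcompA -kg' -mcompA g'h0 mcompm0.
  by exists u; apply: mb; rewrite mcompA bf'.
Qed.

End AbelianSES.

Lemma op_ses (C : preadditive) (A B D : C) (f : mor A B) (g : mor B D) :
  short_exact f g -> @short_exact (op_preadditive C) D B A g f.
Proof. by case. Qed.

(** Dual to [ses_preimage]: [B] is the quotient of [A] by the subobject [K] of [A']. *)
Lemma ses_quotient (C : abelian_category) (A' A F K Q : C) (f : mor A' A)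
    (g : mor A F) (k : mor K A') (c : mor A' Q) :
  short_exact f g -> short_exact k c ->
  exists B (b : mor A B) (f' : mor Q B) (g' : mor B F),
    [/\ short_exact f' g', short_exact (f \o k) b, g' \o b = g & b \o f = f' \o c].
Proof.
move=> /op_ses fg /op_ses kc.
have [B [b [g' [f' [fg' fb e1 e2]]]]] := @ses_preimage (op_abelian C) _ _ _ _ _ _ _ _ _ fg kc.
exists B, b, f', g'; split=> //; last by case: fb.
by case: fg'.
Qed.

(** * Filtrations and the Jordan-Hoelder theorem *)

Lemma Forall_cat T (Q : T -> Prop) (s t : seq T) :
  List.Forall Q (s ++ t) <-> List.Forall Q s /\ List.Forall Q t.
Proof. exact: List.Forall_app. Qed.

Lemma Forall_rcons T (Q : T -> Prop) (s : seq T) (x : T) :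
  List.Forall Q (rcons s x) <-> List.Forall Q s /\ Q x.
Proof.
rewrite -cats1 Forall_cat; split=> -[? Qx]; split=> //; last by constructor.
by inversion Qx.
Qed.

Lemma In_rcons T (s : seq T) (x y : T) : List.In y (rcons s x) <-> List.In y s \/ y = x.
Proof.
elim: s => [|z s IHs] /=; first by split=> [[->|//]|[//|->]]; [right|left].
by rewrite IHs; tauto.
Qed.

Section Filtrations.
Context (C : abelian_category).
Implicit Types (A B D F G S T X : C) (Fs Gs : seq C).

Lemma filtration_nilP A : filtration A [::] -> is_zero A.
Proof.
move=> fA; have [Fs eFs] : exists Fs : seq C, Fs = [::] by exists [::].
by rewrite -eFs in fA; case: fA eFs => // ? ? ? [].
Qed.

Lemma filtration_rconsP A Fs F : filtration A (rcons Fs F) ->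
  exists A' (f : mor A' A) (g : mor A F), filtration A' Fs /\ short_exact f g.
Proof.
move=> fA; have [Gs eGs] : exists Gs : seq C, Gs = rcons Fs F by exists (rcons Fs F).
rewrite -eGs in fA; case: fA eGs => [? ? eq0|A' B F' Fs' f g fA' fg /rcons_inj[<- eF]].
  by move/(congr1 size): eq0; rewrite size_rcons.
by move: F' g fg eF => F' g fg eF; subst F'; exists A', f, g.
Qed.

Lemma filtration_iso A B Fs : isomorphic A B -> filtration A Fs -> filtration B Fs.
Proof.
move=> AB fA; case: fA AB => [{}A zA|A' {}A F {}Fs f g fA' fg] [u [v [vu uv]]].
  by constructor; apply: isomorphic_zero zA; exists u, v.
exact: filtration_rcons fA' (ses_iso_middle fg uv vu).
Qed.

(** The steps of the filtration of the quotient [F] are replaced by their preimages in [A], which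
    contain [A']. *)
Lemma filtration_cat A' A F Fs Gs (f : mor A' A) (g : mor A F) :
  short_exact f g -> filtration A' Fs -> filtration F Gs -> filtration A (Fs ++ Gs).
Proof.
move=> fg fA' fF; elim: fF A f g fg => {F Gs}.
  move=> Z zZ A f g fg; rewrite cats0; apply: filtration_iso fA'.
  by exists f; apply: ses_zero_epi fg zZ.
move=> F' F G Gs k c _ IH kc A f g fg.
have [B [b [f' [g' [fg' bcg _ _]]]]] := ses_preimage fg kc.
rewrite -rcons_cat; exact: filtration_rcons (IH _ _ _ fg') bcg.
Qed.

Lemma filtration1 A : filtration A [:: A].
Proof.
have [Z zZ] := has_zero_object C.
apply: (@filtration_rcons _ Z A A [::] 0 (idm A)); first exact: filtration_nil.
apply: ses_of_kernel; first exact: iso_epi (iso_idm A).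
apply: is_kernelP; first by move=> X u v _; rewrite (mor_to_zero u) ?(mor_to_zero v).
  exact: mcompm0.
by move=> X h; rewrite mcomp1m => ->; exists 0; rewrite mcompm0.
Qed.

Lemma Filt_iso (Q : C -> Prop) A B : isomorphic A B -> Filt Q A -> Filt Q B.
Proof. by move=> AB [Fs fA QFs]; exists Fs => //; apply: filtration_iso fA. Qed.

Lemma Filt_ses (Q : C -> Prop) A' A F (f : mor A' A) (g : mor A F) :
  short_exact f g -> Filt Q A' -> Filt Q F -> Filt Q A.
Proof.
move=> fg [Fs fA' QFs] [Gs fF QGs]; exists (Fs ++ Gs); first exact: filtration_cat fg _ _.
exact/Forall_cat.
Qed.

Lemma Filt_zero (Q : C -> Prop) A : is_zero A -> Filt Q A.
Proof. by move=> zA; exists [::] => //; apply: filtration_nil. Qed.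

Lemma Filt_incl (Q : C -> Prop) A : Q A -> Filt Q A.
Proof.
move=> QA; exists [:: A]; first exact: filtration1.
by constructor=> //; exists A => //; apply: isomorphic_refl.
Qed.

Lemma Filt_sub (Q Q' : C -> Prop) A : (forall X, Q X -> Q' X) -> Filt Q A -> Filt Q' A.
Proof.
move=> QQ' [Fs fA QFs]; exists Fs => //; apply: List.Forall_impl QFs => F [X QX FX].
by exists X => //; apply: QQ'.
Qed.

(** The factors of a filtration lie in [Q] only up to isomorphism. Composing the quotient map with
    that isomorphism lets the induction step assume [Q F] itself. *)
Lemma Filt_ind (Q P : C -> Prop) :
  (forall A, is_zero A -> P A) ->
  (forall A' A F, Filt Q A' -> P A' -> Q F ->
     forall (f : mor A' A) (g : mor A F), short_exact f g -> P A) ->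
  forall A, Filt Q A -> P A.
Proof.
move=> P0 PS A [Fs fA]; elim: fA => {A Fs} [A zA _|A' A F Fs f g fA' IH fg].
  exact: P0.
move=> /Forall_rcons[QFs [X QX [u iu]]].
apply: PS (ses_iso_quotient fg iu) => //; [by exists Fs|exact: IH].
Qed.

Lemma Filt_filtration (Q : C -> Prop) A Fs :
  filtration A Fs -> List.Forall (Filt Q) Fs -> Filt Q A.
Proof.
elim=> {A Fs} [A zA _|A' A F Fs f g _ IH fg /Forall_rcons[/IH QA' QF]].
  exact: Filt_zero.
exact: Filt_ses fg QA' QF.
Qed.

Lemma mor_from_Filt (Q : C -> Prop) A T (h : mor A T) :
  (forall X (u : mor X T), Q X -> u = 0) -> Filt Q A -> h = 0.
Proof.
move=> Q0 QA; elim/Filt_ind: QA h => [B zB|A' B F _ IH QF f g fg] h.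
  exact: mor_from_zero.
have [u <-] := ses_desc fg (IH (h \o f)).
by rewrite (Q0 _ u) // mcomp0m.
Qed.

Lemma mor_to_Filt (Q : C -> Prop) A T (h : mor T A) :
  (forall X (u : mor T X), Q X -> u = 0) -> Filt Q A -> h = 0.
Proof.
move=> Q0 QA; elim/Filt_ind: QA h => [B zB|A' B F _ IH QF f g fg] h.
  exact: mor_to_zero.
have [u <-] := ses_lift fg (Q0 _ (g \o h) QF).
by rewrite (IH u) mcompm0.
Qed.

Lemma to_simple_epi A T (f : mor A T) : simple_object T -> f <> 0 -> is_epi f.
Proof.
move=> [_ sT] f0; have [I [e [m [ee mm me]]]] := image_factorization f.
case: (sT _ _ mm) => [zI|im]; last by rewrite -me; exact: epi_comp (iso_epi im) ee.
by case: f0; rewrite -me (mor_from_zero m zI) mcomp0m.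
Qed.

Lemma simple_epi_iso A T (f : mor T A) :
  simple_object T -> ~ is_zero A -> is_epi f -> is_iso f.
Proof.
move=> [_ sT] nA ef; have [K [k kf]] := ses_of_epi ef.
case: (sT _ _ (ses_mono kf)) => [zK|ik]; first exact: ses_zero_mono kf zK.
by case: nA; apply: ses_iso_zero_epi kf ik.
Qed.

End Filtrations.

(** * Composition series, multiplicities and length *)

Section JordanHolder.
Context (C : abelian_category) (lenC : length_category C).
Implicit Types (A B D F G S T X : C) (Fs Gs : seq C).

Lemma jordan_holder_cat A' A F Fs Gs (f : mor A' A) (g : mor A F) :
  short_exact f g -> jordan_holder A' Fs -> jordan_holder F Gs ->
  jordan_holder A (Fs ++ Gs).
Proof.
move=> fg [fA' sFs] [fF sGs]; split; first exact: filtration_cat fg _ _.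
exact/Forall_cat.
Qed.

Lemma jordan_holder1 F : simple_object F -> jordan_holder F [:: F].
Proof. by move=> sF; split; [exact: filtration1|constructor]. Qed.

Lemma jordan_holder_zero A Fs : is_zero A -> jordan_holder A Fs -> Fs = [::].
Proof.
move=> zA []; case/lastP: Fs => // Fs F /filtration_rconsP[A' [f [g [_ fg]]]].
by move=> /Forall_rcons[_ [+ _]]; case; apply: epi_from_zero (ses_epi fg) zA.
Qed.

(* Taking [p] to be constantly true gives invariance of the length, which the
   induction itself needs. *)
Lemma jordan_holder_count A Fs Gs (p : pred C) :
  (forall F G, isomorphic F G -> p F = p G) ->
  jordan_holder A Fs -> jordan_holder A Gs -> count p Fs = count p Gs.
Proof.
have [k] := ubnP (size Fs); elim: k => // k IHk in A Fs Gs p *.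
case/lastP: Fs => [|Fs F] sk pI jF jG.
  by rewrite (jordan_holder_zero (filtration_nilP (proj1 jF)) jG).
case/lastP: Gs jG => [|Gs G] jG.
  by rewrite (jordan_holder_zero (filtration_nilP (proj1 jG)) jF).
move: sk; rewrite size_rcons ltnS => sk.
case: jF => /filtration_rconsP[A1 [f1 [g1 [fA1 s1]]]] /Forall_rcons[sFs sF].
case: jG => /filtration_rconsP[A2 [f2 [g2 [fA2 s2]]]] /Forall_rcons[sGs sG].
have j1 : jordan_holder A1 Fs by [].
rewrite -!cats1 !count_cat.
(* If one simple quotient map kills the kernel of the other, it factors through it by an
   isomorphism; then the two maximal subobjects coincide. *)
have comm D D' (g : mor A D) (g' : mor A D') A0 (f : mor A0 A) A0' (f' : mor A0' A) :
    short_exact f g -> short_exact f' g' -> simple_object D -> simple_object D' ->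
    g' \o f = 0 -> isomorphic D D' /\ g \o f' = 0.
  move=> fg fg' sD [nD' _] /(ses_desc fg)[u ug].
  have iu : is_iso u.
    apply: (simple_epi_iso sD nD'); apply: (@epi_of_comp _ _ _ _ u g).
    by rewrite ug; apply: ses_epi fg'.
  split; first by exists u.
  by apply: (iso_mono iu); rewrite mcompA ug (ses_comp fg') mcompm0.
have [z12|nz12] := pselect (g1 \o f2 = 0).
  have [GF z21] := comm _ _ _ _ _ _ _ _ s2 s1 sG sF z12.
  rewrite /= (pI _ _ GF); congr (_ + _)%N; apply: (IHk A1) => //; split=> //.
  by apply: filtration_iso fA2; apply: kernel_isomorphic (proj1 s2) (proj1 s1) _ _.
have e12 := to_simple_epi sF nz12.
have nz21 : g2 \o f1 <> 0.
  by move=> z21; apply: nz12; have [] := comm _ _ _ _ _ _ _ _ s1 s2 sF sG z21.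
have e21 := to_simple_epi sG nz21.
(* For distinct maximal subobjects, [B] is the intersection of [A1] and [A2]; the quotients are
   [A2/B = F] and [A1/B = G], so a composition series of [B] extends to both. *)
have [B [b sb]] := ses_of_epi e12.
have [|c f1c] := ses_lift (h := f2 \o b) s1; first by rewrite mcompA (ses_comp sb).
have sc : short_exact c (g2 \o f1).
  apply: ses_of_kernel => //; apply: is_kernelP.
  - apply: (@mono_of_comp _ _ _ _ f1); rewrite f1c.
    exact: mono_comp (ses_mono s2) (ses_mono sb).
  - by rewrite -mcompA f1c mcompA (ses_comp s2) mcomp0m.
  - move=> X h; rewrite -mcompA => /(ses_lift s2)[u f2u].
    have [|v bv] := ses_lift (h := u) sb.
      by rewrite -mcompA f2u mcompA (ses_comp s1) mcomp0m.
    exists v; apply: (ses_mono s1).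
    by rewrite mcompA f1c -mcompA bv.
have [Hs jB] := lenC B.
have jBG := jordan_holder_cat sc jB (jordan_holder1 sG).
have jBF := jordan_holder_cat sb jB (jordan_holder1 sF).
(* Invariance of the length for [A1] bounds the series of [A2], so that the induction hypothesis
   applies to [A2] as well. *)
have sHs : size (Hs ++ [:: F]) = size Fs.
  have := IHk _ _ _ predT sk (fun _ _ _ => erefl) j1 jBG.
  by rewrite !count_predT => ->; rewrite !size_cat.
rewrite (IHk _ _ _ p sk pI j1 jBG).
rewrite -(IHk A2 (Hs ++ [:: F]) Gs p _ pI jBF) ?sHs //.
by rewrite !count_cat addnAC.
Qed.

Lemma isomorphic_eq S F G : isomorphic F G ->
  `[< isomorphic F S >] = `[< isomorphic G S >] :> bool.
Proof.
move=> FG; apply/asboolP/asboolP; first exact/isomorphic_trans/isomorphic_sym.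
exact: isomorphic_trans.
Qed.

Lemma multE A S Fs : jordan_holder A Fs ->
  mult A S = count (fun F => `[< isomorphic F S >]) Fs.
Proof.
move=> jA; rewrite /mult; set c := count _; set X := (X in xget _ X).
have [Gs jG <-] : X (xget 0%N X) by apply: xgetPex; exists (c Fs), Fs.
by apply: jordan_holder_count jG jA => F G; apply: isomorphic_eq.
Qed.

Lemma obj_lengthE A Fs : jordan_holder A Fs -> obj_length A = size Fs.
Proof.
move=> jA; rewrite /obj_length; set X := (X in xget _ X).
have [Gs jG <-] : X (xget 0%N X) by apply: xgetPex; exists (size Fs), Fs.
by rewrite -!count_predT; apply: jordan_holder_count jG jA.
Qed.

Lemma mult_ses A B D S (f : mor A B) (g : mor B D) :
  short_exact f g -> mult B S = (mult A S + mult D S)%N.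
Proof.
move=> fg; have [Fs jA] := lenC A; have [Gs jD] := lenC D.
by rewrite (multE _ (jordan_holder_cat fg jA jD)) (multE _ jA) (multE _ jD) count_cat.
Qed.

Lemma obj_length_ses A B D (f : mor A B) (g : mor B D) :
  short_exact f g -> obj_length B = (obj_length A + obj_length D)%N.
Proof.
move=> fg; have [Fs jA] := lenC A; have [Gs jD] := lenC D.
rewrite (obj_lengthE (jordan_holder_cat fg jA jD)) (obj_lengthE jA).
by rewrite (obj_lengthE jD) size_cat.
Qed.

Lemma obj_length_eq0 A : obj_length A = 0%N <-> is_zero A.
Proof.
have [Fs jA] := lenC A; rewrite (obj_lengthE jA).
split=> [|zA]; last by rewrite (jordan_holder_zero zA jA).
by case: Fs jA => // -[/filtration_nilP].
Qed.

Lemma obj_length_gt0 A : ~ is_zero A -> (0 < obj_length A)%N.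
Proof. by rewrite lt0n => nA; apply/eqP => /obj_length_eq0. Qed.

Lemma mult_zero A S : is_zero A -> mult A S = 0%N.
Proof.
move=> zA; have [Fs jA] := lenC A.
by rewrite (multE _ jA) (jordan_holder_zero zA jA).
Qed.

Lemma mult_simple T S : simple_object T -> mult T S = `[< isomorphic T S >].
Proof. by move=> sT; rewrite (multE _ (jordan_holder1 sT)) /= addn0. Qed.

Lemma mult_le_length A S : (mult A S <= obj_length A)%N.
Proof. by have [Fs jA] := lenC A; rewrite (multE _ jA) (obj_lengthE jA) count_size. Qed.

Lemma mult_quotient A B S (g : mor A B) : is_epi g -> (mult B S <= mult A S)%N.
Proof. by move=> /ses_of_epi[K [k kg]]; rewrite (mult_ses _ kg) leq_addl. Qed.

Lemma mult_sub A B S (f : mor A B) : is_mono f -> (mult A S <= mult B S)%N.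
Proof. by move=> /ses_of_mono[K [k kg]]; rewrite (mult_ses _ kg) leq_addr. Qed.

Lemma obj_length_quotient A B (g : mor A B) : is_epi g -> (obj_length B <= obj_length A)%N.
Proof. by move=> /ses_of_epi[K [k kg]]; rewrite (obj_length_ses kg) leq_addl. Qed.

End JordanHolder.

(** * Functions additive on short exact sequences *)

Section AdditiveFunctions.
Context (C : abelian_category) (V : zmodType) (a : C -> V).
Hypothesis a_ses : forall (A B D : C) (f : mor A B) (g : mor B D),
  short_exact f g -> a B = a A + a D.
Implicit Types (A B : C).

Lemma additive_zero A : is_zero A -> a A = 0.
Proof.
move=> zA; apply: (addrI (a A)); rewrite addr0.
(* For a zero object this sequence is exact, so additivity reads [a A = a A + a A]. *)
have sA : short_exact (0 : mor A A) (0 : mor A A).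
  apply: ses_of_kernel; first by move=> X u v _; rewrite (mor_from_zero u) ?(mor_from_zero v).
  apply: is_kernelP; first by move=> X u v _; rewrite (mor_to_zero u) ?(mor_to_zero v).
    exact: mcompm0.
  by move=> X h _; exists 0; rewrite (mor_to_zero h zA) mcompm0.
by rewrite -(a_ses sA).
Qed.

Lemma additive_iso A B : isomorphic A B -> a A = a B.
Proof.
case=> f iF; have [K [k kf]] := ses_of_epi (iso_epi iF).
by rewrite (a_ses kf) (additive_zero (ses_iso_zero_mono kf iF)) add0r.
Qed.

Lemma additive_mult (n : nat) (S : 'I_n -> C) A :
  length_category C -> simple_representatives S ->
  a A = \sum_i a (S i) *+ mult A (S i).
Proof.
move=> lenC [sS injS repS]; have [Fs [fA]] := lenC A.
elim: fA => {A Fs} [A zA _|A' A F Fs f g _ IH fg /Forall_rcons[/IH aA' sF]].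
  by rewrite additive_zero // big1 // => i _; rewrite mult_zero.
under eq_bigr do rewrite (mult_ses lenC _ fg) mulrnDr.
rewrite big_split /= -aA' (a_ses fg); congr (_ + _).
have [k Fk] := repS _ sF; rewrite (bigD1 k) //= big1 ?addr0; last first.
  move=> i ik; rewrite mult_simple //; case: asboolP => // Fi.
  move/eqP: ik; case; apply: injS.
  exact: isomorphic_trans (isomorphic_sym Fi) Fk.
by rewrite mult_simple // asboolT // (additive_iso Fk).
Qed.

End AdditiveFunctions.

Lemma obj_length_sum_mult (C : abelian_category) (n : nat) (S : 'I_n -> C) (A : C) :
  length_category C -> simple_representatives S ->
  obj_length A = (\sum_i mult A (S i))%N.
Proof.
move=> lenC repS; have sS := let: And3 sS _ _ := repS in sS.
(* Lengths are cast to [int], because [additive_mult] takes values in an additive group. *)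
have aS (X Y W : C) (f : mor X Y) (g : mor Y W) : short_exact f g ->
    (obj_length Y)%:Z = (obj_length X)%:Z + (obj_length W)%:Z.
  by move=> fg; rewrite (obj_length_ses lenC fg) PoszD.
have /= := @additive_mult C int (fun X => (obj_length X)%:Z) aS _ S A lenC repS.
under eq_bigr do rewrite (obj_lengthE lenC (jordan_holder1 (sS _))) /=.
by rewrite -natr_sum natz => -[].
Qed.

(** * The Grothendieck group and phases *)

Section GrothendieckGroup.
Context (C : preadditive).

Lemma K0_class_ses (A B D : C) (f : mor A B) (g : mor B D) :
  short_exact f g -> K0_class B = K0_class A + K0_class D.
Proof.
move=> fg; rewrite /K0_class -pi_addr; apply/eqP; rewrite -Quotient.idealrBE.
rewrite opprD addrA; apply/asboolP => G _ ses; exact: ses fg.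
Qed.

(** Universal property of the Grothendieck group. The kernel of the linear extension [l] is a
    subgroup containing the defining relations, hence contains [K0_relations], the smallest such
    subgroup; so [l] descends to the quotient. *)
Lemma K0_lift (V : zmodType) (a : C -> V) :
  (forall (A B D : C) (f : mor A B) (g : mor B D),
     short_exact f g -> a B = a A + a D) ->
  exists Z : {additive K0 C -> V}, forall A : C, Z (K0_class A) = a A.
Proof.
move=> a_ses; pose l : free_on_objects C -> V := @fglift int (zmodule V) {classic C} a.
have lB : {morph l : x y / x - y} by exact: (@lift_is_additive int {classic C} (zmodule V) a).
have lU A : l (obj_gen A) = a A by rewrite /l liftU scale1r.
have lK x : x \in @K0_relations C -> l x = 0.
  move=> /asboolP /(_ [pred y | l y == 0]) lx; apply/eqP; apply: lx.
    split; first by rewrite inE -[X in l X](subrr 0) lB subrr.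
    by move=> y z; rewrite !inE lB => /eqP -> /eqP ->; rewrite subrr.
  by move=> A B D f g /a_ses aB; rewrite inE !lB !lU aB -addrA -opprD subrr.
pose z (x : K0 C) := l (repr x).
have zpi x : z (\pi_(K0 C) x) = l x.
  apply/eqP; rewrite -subr_eq0 -lB; apply/eqP/lK.
  by rewrite Quotient.idealrBE reprK.
have zB : zmod_morphism z.
  by move=> x y; rewrite -[x]reprK -[y]reprK -pi_oppr -pi_addr !zpi lB.
pose Zm := GRing.isZmodMorphism.Build _ _ z zB.
pose Z : {additive K0 C -> V} := HB.pack z Zm.
by exists Z => A; rewrite /= zpi.
Qed.

End GrothendieckGroup.

(** * Comparison of phases by the sign of a determinant *)

Section Phase.
Context (R : realType).
Implicit Types (z w : R[i]) (t s : R).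

(* The imaginary part of [conj z * w]; on the semiclosed upper half plane its sign
   compares phases, because these differ by less than 1. *)
Definition cross z w : R :=
  complex.Re z * complex.Im w - complex.Im z * complex.Re w.

Lemma crossDl z1 z2 w : cross (z1 + z2) w = cross z1 w + cross z2 w.
Proof. case: z1 z2 w => [a b] [c d] [e f]; rewrite /cross /=; ring. Qed.

Lemma crossC z w : cross w z = - cross z w.
Proof. rewrite /cross; ring. Qed.

Lemma crossDr z w1 w2 : cross z (w1 + w2) = cross z w1 + cross z w2.
Proof. by rewrite crossC crossDl opprD -!crossC. Qed.

Lemma crosszz z : cross z z = 0.
Proof. rewrite /cross; ring. Qed.

Lemma cross0l w : cross 0 w = 0.
Proof. rewrite /cross /=; ring. Qed.

(** In polar form the cross product is [r * q * sin (pi * s - pi * t)], and the sine is positive on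
    the open interval from 0 to [pi]. *)
Lemma has_phase_lt z w t s : has_phase z t -> has_phase w s ->
  (t < s) = (0 < cross z w).
Proof.
have pos z0 w0 t0 s0 : has_phase z0 t0 -> has_phase w0 s0 -> t0 < s0 -> 0 < cross z0 w0.
  move=> [/andP[t0_gt0 t0_le1] [r r0 ->]] [/andP[s0_gt0 s0_le1] [q q0 ->]] ts.
  have -> : cross (r%:C%C * expipi t0) (q%:C%C * expipi s0)
      = r * q * sin (pi * s0 - pi * t0).
    rewrite sinB /cross /expipi /=; ring.
  rewrite mulr_gt0 ?mulr_gt0 //; apply: sin_gt0_pi; rewrite -mulrBr.
  rewrite mulr_gt0 ?pi_gt0 ?subr_gt0 //=.
  by rewrite -[ltRHS]mulr1 ltr_pM2l ?pi_gt0 //; lra.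
move=> zt ws; apply/idP/idP; first exact: pos zt ws.
case: (ltgtP t s) => // [st|e].
  by rewrite crossC oppr_gt0 ltNge ltW // (pos _ _ _ _ ws zt).
case: zt ws => _ [r _ ->] [_ [q _ ->]]; rewrite e.
suff -> : cross (r%:C%C * expipi s) (q%:C%C * expipi s) = 0 by rewrite ltxx.
rewrite /cross /expipi /=; ring.
Qed.

(** With modulus [r], the phase is [acos (x / r) / pi]; as [y] is positive, the sine of this
    arccosine is [y / r]. *)
Lemma semiclosed_upper_half_plane_Im z :
  0 < complex.Im z -> semiclosed_upper_half_plane z.
Proof.
case: z => x y /= y0; pose r := Num.sqrt (x ^+ 2 + y ^+ 2).
have r2 : r ^+ 2 = x ^+ 2 + y ^+ 2 by rewrite sqr_sqrtr // addr_ge0 ?sqr_ge0.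
have r0 : 0 < r by rewrite sqrtr_gt0 ltr_wpDl ?sqr_ge0 // exprn_gt0.
have xr : `|x| < r.
  by rewrite -ltr_sqr ?nnegrE ?normr_ge0 ?ltW // real_normK ?num_real // r2 ltrDl exprn_gt0.
have c1 : -1 < x / r < 1.
  by rewrite ltr_pdivlMr // ltr_pdivrMr // mulN1r mul1r -ltr_norml.
have {c1} [c1 c2] := andP c1.
have sE : Num.sqrt (1 - (x / r) ^+ 2) = y / r.
  rewrite -[RHS]ger0_norm ?divr_ge0 ?ltW // -sqrtr_sqr; congr Num.sqrt.
  rewrite !expr_div_n r2; field; rewrite -r2 sqrf_eq0; exact: lt0r_neq0.
have pi0 := pi_gt0 R.
exists (acos (x / r) / pi); split.
  rewrite divr_gt0 //= ?acos_gt0 ?(ltW c1) //=.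
  by rewrite ler_pdivrMr // mul1r acos_lepi ?(ltW c1) ?(ltW c2).
exists r => //; rewrite /expipi mulrCA divff ?lt0r_neq0 // mulr1.
rewrite acosK ?in_itv /= ?(ltW c1) ?(ltW c2) // sin_acos ?(ltW c1) ?(ltW c2) // sE.
apply/eqP; rewrite eq_complex /= !mul0r subr0 addr0.
by rewrite ![r * _]mulrC !divfK ?lt0r_neq0 // !eqxx.
Qed.

End Phase.

(** * Harder-Narasimhan filtrations *)

Lemma cokernel_isomorphic (C : preadditive) (A B A' Q Q' : C) (q : mor B Q)
    (q' : mor B Q') (f : mor A B) (f' : mor A' B) :
  is_cokernel q f -> is_cokernel q' f' -> q' \o f = 0 -> q \o f' = 0 ->
  isomorphic Q Q'.
Proof.
move=> cq cq' /(cokernel_desc cq)[u uq] /(cokernel_desc cq')[v vq].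
exists u, v; split.
  by apply: (cokernel_epi cq); rewrite -mcompA uq vq mcomp1m.
by apply: (cokernel_epi cq'); rewrite -mcompA vq uq mcomp1m.
Qed.

Lemma Forall_allP T (p : pred T) (s : seq T) : all p s <-> List.Forall p s.
Proof.
elim: s => [|x s IHs] /=; first by split.
by split=> [/andP[px /IHs]|fs]; [constructor|inversion fs; apply/andP; split=> //; apply/IHs].
Qed.

Section HarderNarasimhan.
Context (R : realType) (C : abelian_category) (Z : {additive K0 C -> R[i]}).
Hypothesis Z_stab : stability_function Z.
Implicit Types (A B F G X Y : C) (Fs Gs : seq C).

Local Notation z A := (Z (K0_class A)).

Lemma charge_ses A B X (f : mor A B) (g : mor B X) : short_exact f g -> z B = z A + z X.
Proof. by move=> /K0_class_ses ->; rewrite raddfD. Qed.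

Lemma charge_zero A : is_zero A -> z A = 0.
Proof. exact: (@additive_zero C _ (fun A => z A) charge_ses). Qed.

Lemma charge_iso A B : isomorphic A B -> z A = z B.
Proof. exact: (@additive_iso C _ (fun A => z A) charge_ses). Qed.

Lemma phaseP A : ~ is_zero A -> has_phase (z A) (phase Z A).
Proof. by move=> /Z_stab[t zt]; rewrite /phase; apply: xgetPex; exists t. Qed.

Lemma phase_ltE A B : ~ is_zero A -> ~ is_zero B ->
  (phase Z A < phase Z B) = (0 < cross (z A) (z B)).
Proof. by move=> /phaseP pA /phaseP pB; apply: has_phase_lt. Qed.

Lemma phase_leE A B : ~ is_zero A -> ~ is_zero B ->
  (phase Z A <= phase Z B) = (0 <= cross (z A) (z B)).
Proof. by move=> nA nB; rewrite leNgt phase_ltE // crossC oppr_gt0 -leNgt. Qed.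

(** The cross product form of semistability also covers zero subobjects and isomorphisms, which
    avoids case distinctions later. *)
Lemma semistable_cross F Y (f : mor Y F) :
  semistable Z F -> is_mono f -> 0 <= cross (z Y) (z F).
Proof.
move=> [nF sF] mf; have [zY|nY] := pselect (is_zero Y).
  by rewrite charge_zero // cross0l.
have [iF|niF] := pselect (is_iso f); last by rewrite -phase_leE //; apply: sF niF.
by rewrite (@charge_iso Y F) ?crosszz //; exists f.
Qed.

(** The image is a quotient of [F] and a subobject of [G], so a nonzero [h] would force the phase of
    [F] to be at most that of [G]. *)
Lemma semistable_hom F G (h : mor F G) :
  semistable Z F -> semistable Z G -> phase Z G < phase Z F -> h = 0.
Proof.
move=> sF sG GF; have nF := proj1 sF; have nG := proj1 sG.
have [I [e [m [ee mm <-]]]] := image_factorization h.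
have [zI|nI] := pselect (is_zero I); first by rewrite (mor_from_zero m zI) mcomp0m.
have [K [k ke]] := ses_of_epi ee.
have IG : phase Z I <= phase Z G by rewrite phase_leE //; apply: semistable_cross mm.
(* See-saw: since the charge of [F] is the sum of those of [K] and [I], comparing [K] with [F] and
   comparing [F] with [I] give the same cross product, that of [K] with [I]. *)
have FI : phase Z F <= phase Z I.
  have := semistable_cross sF (ses_mono ke).
  by rewrite phase_leE // (charge_ses ke) crossDr crossDl !crosszz add0r addr0.
by have := lt_le_trans GF (le_trans FI IG); rewrite ltxx.
Qed.

Lemma semistable_filtration_hom A Fs G (h : mor A G) :
  filtration A Fs -> List.Forall (semistable Z) Fs -> semistable Z G ->
  all (fun F => phase Z G < phase Z F) Fs -> h = 0.
Proof.
move=> fA sFs sG /Forall_allP GFs.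
apply: (@mor_from_Filt _ (fun X => semistable Z X /\ phase Z G < phase Z X)).
  by move=> X u [sX GX]; apply: semistable_hom sX sG GX.
exists Fs => //; apply: List.Forall_impl (List.Forall_and sFs GFs) => F QF.
by exists F => //; apply: isomorphic_refl.
Qed.

Lemma sorted_phase_rcons Fs F :
  sorted (fun F G => phase Z G < phase Z F) (rcons Fs F) =
  all (fun G => phase Z F < phase Z G) Fs &&
  sorted (fun F G => phase Z G < phase Z F) Fs.
Proof.
have tr : transitive (fun F G : C => phase Z G < phase Z F).
  by move=> Y X W XY YW; apply: lt_trans YW XY.
by rewrite !(sorted_pairwise tr) pairwise_rcons.
Qed.

Lemma hn_last_min A Fs F G (h : mor A G) :
  harder_narasimhan Z A (rcons Fs F) -> semistable Z G -> h <> 0 ->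
  phase Z F <= phase Z G.
Proof.
case=> fA sFs oFs sG nh; rewrite leNgt; apply/negP => GF; apply: nh.
apply: semistable_filtration_hom fA sFs sG _; rewrite all_rcons GF /=.
move: oFs; rewrite sorted_phase_rcons => /andP[+ _].
by apply: sub_all => X; apply: lt_trans.
Qed.

Lemma epi_neq0 A F (g : mor A F) : is_epi g -> ~ is_zero F -> g <> 0.
Proof. by move=> eg nF g0; apply: nF; apply/is_zeroP/eg; rewrite g0 !mcompm0. Qed.

(** By [hn_last_min] in both directions the last factors have equal phase. All lower factors have
    larger phase, so each of the two last quotient maps kills the other's kernel. Hence the last
    factors agree, and so do the kernels, to which the induction applies. *)
Lemma hn_unique A Fs Gs F :
  harder_narasimhan Z A Fs -> harder_narasimhan Z A Gs -> List.In F Fs ->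
  exists2 G, List.In G Gs & isomorphic F G.
Proof.
elim/last_ind: Fs => // Fs F1 IH in A Gs * => hF.
case/lastP: Gs => [|Gs G1] hG.
  have zA := filtration_nilP (let: And3 fA _ _ := hG in fA).
  case: hF => /filtration_rconsP[A' [f [g [_ fg]]]] /Forall_rcons[_ [+ _]] _.
  by case; apply: epi_from_zero (ses_epi fg) zA.
have [fF /Forall_rcons[sFs sF1] oF] := hF; have [fG /Forall_rcons[sGs sG1] oG] := hG.
have [A1 [f1 [g1 [fA1 s1]]]] := filtration_rconsP fF.
have [A2 [f2 [g2 [fA2 s2]]]] := filtration_rconsP fG.
have ph : phase Z F1 = phase Z G1.
  apply/eqP; rewrite eq_le (hn_last_min hF sG1 (epi_neq0 (ses_epi s2) (proj1 sG1))).
  by rewrite (hn_last_min hG sF1 (epi_neq0 (ses_epi s1) (proj1 sF1))).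
move: oF oG; rewrite !sorted_phase_rcons => /andP[aF oF] /andP[aG oG].
have z12 : g1 \o f2 = 0.
  by apply: semistable_filtration_hom fA2 sGs sF1 _; rewrite ph.
have z21 : g2 \o f1 = 0.
  by apply: semistable_filtration_hom fA1 sFs sG1 _; rewrite -ph.
have FG := cokernel_isomorphic (proj2 s1) (proj2 s2) z21 z12.
have A12 := kernel_isomorphic (proj1 s1) (proj1 s2) z12 z21.
move=> /In_rcons[FFs|->]; last by exists G1 => //; apply/In_rcons; right.
have hF' : harder_narasimhan Z A2 Fs by split=> //; apply: filtration_iso A12 fA1.
have [//|G GGs FG'] := IH _ Gs hF' _ FFs.
by exists G => //; apply/In_rcons; left.
Qed.

(** * Existence of Harder-Narasimhan filtrations *)

Section Existence.
Context (n : nat) (S : 'I_n -> C).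
Hypotheses (lenC : length_category C) (repS : simple_representatives S).

(* The charge of a quotient of [A] depends only on its vector of multiplicities, and
   these vectors are bounded by the length of [A]. *)
Lemma min_phase_quotient A : ~ is_zero A ->
  exists F (g : mor A F), [/\ is_epi g, ~ is_zero F
    & forall X (q : mor A X), is_epi q -> ~ is_zero X -> phase Z F <= phase Z X].
Proof.
move=> nA; pose N := obj_length A; pose T := {ffun 'I_n -> 'I_N.+1}.
(* [inord] loses nothing on quotients of [A], whose multiplicities are at most [N]. As [T] is
   finite, a minimum of the phases is attained. *)
pose vec X : T := [ffun i => inord (mult X (S i))].
pose charge (v : T) := \sum_i z (S i) *+ v i.
pose tphase v := xget 0 [set t | has_phase (charge v) t]%classic.
pose P v := `[< exists X (q : mor A X), [/\ is_epi q, ~ is_zero X & vec X = v] >].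
have vecE X (q : mor A X) : is_epi q -> tphase (vec X) = phase Z X.
  move=> eq; rewrite /tphase /phase; suff -> : charge (vec X) = z X by [].
  rewrite (@additive_mult C _ (fun A => z A) charge_ses _ _ X lenC repS).
  apply: eq_bigr => i _; rewrite ffunE inordK // ltnS.
  exact: leq_trans (mult_le_length lenC _ _) (obj_length_quotient lenC eq).
have PA : P (vec A).
  by apply/asboolP; exists A, (idm A); split=> //; apply/iso_epi/iso_idm.
case: (@arg_minP _ _ _ (vec A) P tphase PA) => v /asboolP[F [g [eg nF <-]]] minF.
exists F, g; split=> // X q eq nX; rewrite -(vecE _ g) // -(vecE _ q) //.
by apply: minF; apply/asboolP; exists X, q.
Qed.

(** Among the quotients of minimal phase one of maximal length is chosen. It serves as the last
    Harder-Narasimhan factor; maximality makes the phases in the kernel strictly larger. *)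
Lemma min_destabilizing_quotient A : ~ is_zero A ->
  exists F (g : mor A F), [/\ is_epi g, ~ is_zero F
    & forall X (q : mor A X), is_epi q -> ~ is_zero X -> phase Z F <= phase Z X /\
        (phase Z X = phase Z F -> obj_length X <= obj_length F)%N].
Proof.
move=> nA; have [F0 [g0 [eg0 nF0 minF0]]] := min_phase_quotient nA.
pose P m := `[< exists X (q : mor A X), [/\ is_epi q, ~ is_zero X,
  phase Z X = phase Z F0 & obj_length X = m] >].
have exP : exists m, P m by exists (obj_length F0); apply/asboolP; exists F0, g0.
have ubP m : P m -> (m <= obj_length A)%N.
  by move=> /asboolP[X [q [eq _ _ <-]]]; apply: obj_length_quotient eq.
case: (ex_maxnP exP ubP) => m /asboolP[F [g [eg nF pF <-]]] maxF.
exists F, g; split=> // X q eq nX; rewrite pF; split; first exact: minF0 eq nX.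
by move=> pX; apply: maxF; apply/asboolP; exists X, q.
Qed.

Lemma hn_exists A : exists Fs, harder_narasimhan Z A Fs.
Proof.
have [k] := ubnP (obj_length A); elim: k => // k IHk in A *; rewrite ltnS => Ak.
have [zA|nA] := pselect (is_zero A).
  by exists [::]; split=> //; apply: filtration_nil.
have [F [g [eg nF minF]]] := min_destabilizing_quotient nA.
have [K [f fg]] := ses_of_epi eg.
have Kk : (obj_length K < k)%N.
  apply: leq_trans Ak; rewrite (obj_length_ses lenC fg) -[ltnLHS]addn0 ltn_add2l.
  exact: obj_length_gt0.
have [Fs [fK sFs oFs]] := IHk K Kk; exists (rcons Fs F); split.
- exact: filtration_rcons fK fg.
- apply/Forall_rcons; split=> //; split=> // Y m mm nY niY.
  (* The quotient of [F] by [Y] is also a quotient of [A], so its phase is at least that of [F]; by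
     see-saw the phase of [Y] is at most that of [F]. *)
  have [Q [q mq]] := ses_of_mono mm.
  have nQ : ~ is_zero Q by move=> zQ; apply: niY; apply: ses_zero_epi mq zQ.
  have [+ _] := minF _ _ (epi_comp (ses_epi mq) eg) nQ.
  by rewrite !phase_leE // (charge_ses mq) crossDr crossDl !crosszz add0r addr0.
- case/lastP: Fs => [//|Fs G] in fK sFs oFs *.
  have [K' [f' [g' [_ fg']]]] := filtration_rconsP fK.
  have /Forall_rcons[_ [nG _]] := sFs.
  (* [X] is [A/K'], an extension of [F] by the last factor [G] of [K]. If its phase equalled that of
     [F], maximality of the length would make [G] zero; so it is larger, and by see-saw so is that
     of [G]. *)
  have [X [b [i [p [ip sb _ _]]]]] := ses_quotient fg fg'.
  have nX : ~ is_zero X by move=> /(epi_from_zero (ses_epi ip)).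
  have [FX lX] := minF _ _ (ses_epi sb) nX.
  have FG : phase Z F < phase Z G.
    move: FX; rewrite le_eqVlt => /predU1P[/esym/lX|].
      rewrite (obj_length_ses lenC ip) -[leqRHS]add0n leq_add2r leqn0 => /eqP.
      by move=> /(obj_length_eq0 lenC).
    by rewrite !phase_ltE // (charge_ses ip) crossDr crosszz addr0.
  rewrite sorted_phase_rcons oFs all_rcons FG /= andbT.
  move: oFs; rewrite sorted_phase_rcons => /andP[+ _].
  by apply: sub_all => Y; apply: lt_trans.
Qed.

End Existence.
End HarderNarasimhan.

(** * Proper standard objects *)

Section SelfExtensions.
Context (R : realType) (C : abelian_category) (Z : {additive K0 C -> R[i]}).
Hypothesis Z_stab : stability_function Z.
Implicit Types (F T Y : C).

Local Notation z A := (Z (K0_class A)).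

Lemma stable_semistable T : stable Z T -> semistable Z T.
Proof. by case=> nT sT; split=> // Y f mf nY niY; apply/ltW/(sT _ f). Qed.

(** Stated with cross products so that the induction may pass through zero objects. A subobject of
    an extension is cut into its intersection with [A'] and its image in [T]. *)
Lemma Filt_semistable_cross T F : semistable Z T -> Filt (fun X => X = T) F ->
  cross (z F) (z T) = 0 /\
  forall Y (m : mor Y F), is_mono m -> 0 <= cross (z Y) (z T).
Proof.
move=> sT; elim/Filt_ind => [A zA|A' A _ _ [cA' sA'] -> f g fg].
  split=> [|Y m mm]; first by rewrite charge_zero // cross0l.
  by rewrite charge_zero ?cross0l //; apply: mono_to_zero mm zA.
split=> [|Y m mm]; first by rewrite (charge_ses _ fg) crossDl cA' crosszz addr0.
have [I [e [i [ee mi ie]]]] := image_factorization (g \o m).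
have [K [k ke]] := ses_of_epi ee.
have [|u fu] := ses_lift (h := m \o k) fg.
  by rewrite mcompA -ie -mcompA (ses_comp ke) mcompm0.
have mu : is_mono u.
  apply: (@mono_of_comp _ _ _ _ f); rewrite fu; exact: mono_comp mm (ses_mono ke).
by rewrite (charge_ses _ ke) crossDl addr_ge0 ?(sA' _ u) ?(semistable_cross Z_stab sT mi).
Qed.

Lemma Filt_semistable T F : semistable Z T -> Filt (fun X => X = T) F ->
  ~ is_zero F -> semistable Z F /\ phase Z F = phase Z T.
Proof.
move=> sT FT nF; have [c0 cY] := Filt_semistable_cross sT FT.
have pF : phase Z F = phase Z T.
  apply/eqP; rewrite eq_le !(phase_leE Z_stab) //; try exact: (proj1 sT).
  by rewrite (crossC (z F)) c0 oppr0 lexx.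
split=> //; split=> // Y m mm nY niY.
by rewrite pF (phase_leE Z_stab) ?(cY _ m) //; exact: (proj1 sT).
Qed.

End SelfExtensions.

(** * Objects with a simple top *)

Section Tops.
Context (C : abelian_category).
Implicit Types (T X Y : C).

(** A nonzero quotient of an object with simple top [T] has the same top: if [p] did not kill the
    kernel of [q], that kernel would be all of [X]. Essentiality of the induced map is tested after
    pulling back along [q]. *)
Lemma essential_epi_quotient T X Y (p : mor X T) (q : mor X Y) :
  simple_object T -> essential_epi p -> is_epi q -> ~ is_zero Y ->
  exists t : mor Y T, essential_epi t.
Proof.
move=> sT [ep ess] eq nY; have [K [k kq]] := ses_of_epi eq.
have [pk0|/(to_simple_epi sT)/ess ek] := pselect (p \o k = 0); last first.
  case: nY; apply/is_zeroP/eq/ek.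
  by rewrite mcomp0m mcomp1m (ses_comp kq) mcomp0m.
have [t tq] := ses_desc kq pk0; exists t; split.
  by apply: (@epi_of_comp _ _ _ _ t q); rewrite tq.
move=> W h eth; have [V [a [b [qa eb]]]] := pullback_epi h eq.
have /ess ea : is_epi (p \o a).
  by rewrite -tq -mcompA qa mcompA; apply: epi_comp.
by apply: (@epi_of_comp _ _ _ _ h b); rewrite -qa; apply: epi_comp.
Qed.

Lemma essential_epi_proper_sub T X Y (t : mor X T) (m : mor Y X) :
  simple_object T -> essential_epi t -> is_mono m -> ~ is_iso m -> t \o m = 0.
Proof.
move=> sT [_ ess] mm nim; have [//|/(to_simple_epi sT)/ess em] := pselect (t \o m = 0).
by case: nim; apply: mono_epi_iso.
Qed.

(** A nonzero image would have top [T], which would then be a composition factor of [Y]. *)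
Lemma essential_epi_hom0 T X Y (t : mor X T) (h : mor X Y) :
  length_category C -> simple_object T -> essential_epi t ->
  mult Y T = 0%N -> h = 0.
Proof.
move=> lenC sT et Y0; have [I [e [m [ee mm <-]]]] := image_factorization h.
have [zI|nI] := pselect (is_zero I); first by rewrite (mor_from_zero m zI) mcomp0m.
have [u [eu _]] := essential_epi_quotient sT et ee nI.
have := leq_trans (mult_quotient lenC T eu) (mult_sub lenC T mm).
by rewrite Y0 mult_simple // asboolT //; apply: isomorphic_refl.
Qed.

(** The retraction [r] is determined by [f \o r = idm B - (s \o p)]. The sequence through [s] and
    [r] exchanges the roles of subobject and quotient. *)
Lemma split_ses A B X (f : mor A B) (p : mor B X) (s : mor X B) :
  short_exact f p -> p \o s = idm X -> exists r : mor B A, short_exact s r.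
Proof.
move=> fp ps; have [|r fr] := ses_lift (h := idm B - (s \o p)) fp.
  by rewrite mcompBr mcompm1 mcompA ps mcomp1m subrr.
have rf : r \o f = idm A.
  apply: (ses_mono fp); rewrite mcompA fr mcompBl mcomp1m -mcompA (ses_comp fp).
  by rewrite mcompm0 subr0 mcompm1.
exists r; apply: ses_of_kernel.
  by apply: (@epi_of_comp _ _ _ _ r f); rewrite rf; apply/iso_epi/iso_idm.
apply: is_kernelP.
- by apply: (@mono_of_comp _ _ _ _ p); rewrite ps; apply/iso_mono/iso_idm.
- apply: (ses_mono fp); rewrite mcompA fr mcompBl mcomp1m -mcompA ps mcompm1.
  by rewrite subrr mcompm0.
- move=> Y h rh0; exists (p \o h); apply/esym/eqP; rewrite -subr_eq0 mcompA.
  by rewrite -[X in X - _]mcomp1m -mcompBl -fr -mcompA rh0 mcompm0.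
Qed.

End Tops.

Section ProperStandardObjects.
Context (A : abelian_category) (n : nat) (S P D E : 'I_n -> A).
Hypotheses (lenA : length_category A) (repS : simple_representatives S)
  (coverP : forall i, projective_cover (P i) (S i))
  (standardD : forall i, standard_object S P i (D i))
  (proper_standardE : forall i, proper_standard_object S D i (E i)).
Implicit Types (i j k : 'I_n) (X Y : A).

Lemma simpleS i : simple_object (S i).
Proof. by case: repS. Qed.

Lemma mult_SS i j : mult (S i) (S j) = (i == j).
Proof.
rewrite (mult_simple lenA _ (simpleS i)); have [_ injS _] := repS; congr nat_of_bool.
apply/asboolP/eqP => [/injS //|->]; exact: isomorphic_refl.
Qed.

Lemma P_neq0 i : ~ is_zero (P i).
Proof.
have [_ [p [ep _]]] := coverP i; move=> /(epi_from_zero ep).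
by case: (simpleS i).
Qed.

Lemma P_quotientE i : exists q : mor (P i) (E i), is_epi q.
Proof.
have [[d ed] _ _] := standardD i; have [[e ee] _ _] := proper_standardE i.
by exists (e \o d); apply: epi_comp.
Qed.

Lemma mult_ES i : mult (E i) (S i) = 1%N.
Proof. by case: (proper_standardE i). Qed.

Lemma mult_ES_gt i k : (i < k)%N -> mult (E i) (S k) = 0%N.
Proof.
move=> ik; have [_ fD _] := standardD i; have [[e ee] _ _] := proper_standardE i.
apply/eqP; rewrite -leqn0; apply: leq_trans (mult_quotient lenA _ ee) _.
elim/Filt_ind: fD => [X zX|X' X _ _ X'0 [j ji ->] f g fg]; first by rewrite mult_zero.
rewrite (mult_ses lenA _ fg) mult_SS; case: eqP => [jk|_]; last by rewrite addn0.
by move: ik; rewrite -jk ltnNge ji.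
Qed.

Lemma E_neq0 i : ~ is_zero (E i).
Proof. by move=> /(mult_zero lenA (S i)); rewrite mult_ES. Qed.

Lemma E_top i : exists t : mor (E i) (S i), essential_epi t.
Proof.
have [_ [p ep]] := coverP i; have [q eq] := P_quotientE i.
exact: essential_epi_quotient (simpleS i) ep eq (@E_neq0 i).
Qed.

Lemma hom_EE_gt j k (h : mor (E j) (E k)) : (k < j)%N -> h = 0.
Proof.
move=> kj; have [t et] := E_top j.
exact: essential_epi_hom0 lenA (simpleS j) et (mult_ES_gt kj).
Qed.

(** As a quotient of [P i], the object [E j] maps onto [S i]; its top being [S j], the quotient
    [S i] has top [S j] too. *)
Lemma top_unique i j (q : mor (P i) (E j)) : is_epi q -> i = j.
Proof.
move=> eq; have [_ [p ep]] := coverP i; case: (repS) => sS injS _.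
have [t [et _]] := essential_epi_quotient (sS i) ep eq (@E_neq0 j).
have [u eu] := E_top j; have [v [ev _]] := essential_epi_quotient (sS j) eu et (proj1 (sS i)).
by apply: injS; exists v; apply: simple_epi_iso ev => //; case: (sS j).
Qed.

(** * Sorting the proper standard filtration of a projective cover *)

Section Stratified.
Hypothesis strat : properly_stratified P E.

Lemma P_presentation i : exists K (k : mor K (P i)) (q : mor (P i) (E i)),
  short_exact k q /\ Filt (fun X => exists2 j : 'I_n, (i <= j)%N & X = E j) K.
Proof.
have := @P_neq0 i; have := strat i; set Q := fun X => _.
suff step X : Filt Q X -> is_zero X \/
    exists K j (k : mor K X) (q : mor X (E j)), short_exact k q /\ Filt Q K.
  move=> /step[//|[K [j [k [q [kq QK]]]]]] _.
  by have ij := top_unique (ses_epi kq); subst j; exists K, k, q.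
elim/Filt_ind=> [Y zY|Y' Y _ QY' _ [j _ ->] f g fg]; first by left.
by right; exists Y', j, f, g.
Qed.

(** Vanishing of Ext^1, in split form. The map from [P j] onto [E j] lifts to [X]; on its kernel [K]
    the lift lands in [F] and vanishes, since [K] is filtered by [E l] with [l >= j > k]. So it
    descends to a section of [p]. *)
Lemma swap_extension j k F X (f : mor F X) (p : mor X (E j)) :
  (k < j)%N -> Filt (fun X => X = E k) F -> short_exact f p ->
  exists (s : mor (E j) X) (r : mor X F), short_exact s r.
Proof.
move=> kj FF fp; have [K [i [q [iq FK]]]] := P_presentation j.
have [projP _] := coverP j; have [w pw] := projP _ _ p q (ses_epi fp).
have [|u fu] := ses_lift (h := w \o i) fp; first by rewrite mcompA pw (ses_comp iq).
have u0 : u = 0.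
  apply: mor_from_Filt FK => Y v [l jl eY]; apply: mor_to_Filt FF => W v' eW.
  by subst Y W; apply: hom_EE_gt; apply: leq_trans jl.
have [|s sq] := ses_desc (h := w) iq; first by rewrite -fu u0 mcompm0.
have [|r sr] := split_ses (s := s) fp; last by exists s, r.
by apply: (ses_epi iq); rewrite -mcompA sq pw mcomp1m.
Qed.

(** A group is an iterated self-extension together with its index; it must be nonzero to be
    semistable. *)
Let good (b : 'I_n * A) := ~ is_zero b.2 /\ Filt (fun X => X = E b.1) b.2.
Let gt (b c : 'I_n * A) := (c.1 < b.1)%N.

Lemma sorted_gt_rcons gs b :
  sorted gt (rcons gs b) = all (fun c : 'I_n * A => (b.1 < c.1)%N) gs && sorted gt gs.
Proof.
have tr : transitive gt by move=> ? ? ? cb ac; apply: ltn_trans ac cb.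
by rewrite !(sorted_pairwise tr) pairwise_rcons.
Qed.

(** One step of an insertion sort: [E j] arrives on top and moves down past groups of smaller index.
    The last clause controls the indices, so that sortedness survives the recursion. *)
Lemma insert_group gs X' X j (f : mor X' X) (g : mor X (E j)) :
  short_exact f g -> filtration X' (map snd gs) -> List.Forall good gs -> sorted gt gs ->
  exists gs', [/\ filtration X (map snd gs'), List.Forall good gs', sorted gt gs'
    & all (fun b : 'I_n * A => (b.1 == j) || (b.1 \in map fst gs)) gs'].
Proof.
elim/last_ind: gs => [|gs [k F] IH] in X' X f g *.
  move=> fg fX' _ _; exists [:: (j, E j)]; split=> //=; last by rewrite eqxx.
    exact: filtration_rcons fX' fg.
  by constructor=> //; split; [exact: E_neq0|exact: Filt_incl].
rewrite !map_rcons sorted_gt_rcons => fg fX' /Forall_rcons[ggs [nF FF]] /andP[kgs sgs].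
have [X1 [f1 [g1 [fX1 s1]]]] := filtration_rconsP fX'.
rewrite /= in nF FF kgs.
have kK : k \in rcons (map fst gs) k by rewrite mem_rcons mem_head.
have gsK : all (fun b : 'I_n * A => (b.1 == j) || (b.1 \in rcons (map fst gs) k)) gs.
  rewrite -(all_map fst (fun l => (l == j) || (l \in rcons (map fst gs) k))).
  by apply/allP => l; rewrite mem_rcons inE => ->; rewrite !orbT.
case: (ltngtP j k) => [jk|kj|jk].
- exists (rcons (rcons gs (k, F)) (j, E j)); split.
  + by rewrite !map_rcons; apply: filtration_rcons fX' fg.
  + by do 2?[apply/Forall_rcons; split=> //]; split; [exact: E_neq0|exact: Filt_incl].
  + rewrite !sorted_gt_rcons all_rcons /= jk kgs sgs !andbT.
    by apply: sub_all kgs => b; apply: ltn_trans.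
  + by rewrite !all_rcons /= eqxx kK orbT gsK.
(* [Y] is [X/X1], an extension of [E j] by [F], which splits. The preimage [B] of [E j] in [X] has
   [B/X1 = E j] and [X/B = F], so [F] stays on top and the insertion continues in [B]. *)
- have [Y [b [f' [g' [fg' sb _ _]]]]] := ses_quotient fg s1.
  have [s [r sr]] := swap_extension kj FF fg'.
  have [B [b' [f2 [g2 [fg2 sb' _ _]]]]] := ses_preimage sb sr.
  have [gs' [fB ggs' sgs' ags']] := IH _ _ _ _ fg2 fX1 ggs sgs.
  exists (rcons gs' (k, F)); split.
  + by rewrite map_rcons; apply: filtration_rcons fB sb'.
  + by apply/Forall_rcons.
  + rewrite sorted_gt_rcons sgs' andbT; apply: sub_all ags' => c /= /orP[/eqP-> //|].
    move=> cgs; move: kgs; rewrite -(all_map fst (fun l : 'I_n => (k < l)%N)).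
    by move=> /allP; apply.
  + rewrite all_rcons kK orbT /=; apply: sub_all ags' => c.
    by rewrite mem_rcons inE => /orP[->//|->]; rewrite !orbT.
- have {jk}jk : j = k by apply: val_inj.
  (* For equal indices [E j] is absorbed: the top group [F] is replaced by [Y], the extension of
     [E j] by [F]. *)
  subst k; have [Y [b [f' [g' [fg' sb _ _]]]]] := ses_quotient fg s1.
  exists (rcons gs (j, Y)); split.
  + by rewrite map_rcons; apply: filtration_rcons fX1 sb.
  + apply/Forall_rcons; split=> //; split=> /=.
      by move=> /(mono_to_zero (ses_mono fg')).
    by apply: Filt_ses fg' FF _; apply: Filt_incl.
  + by rewrite sorted_gt_rcons sgs andbT.
  + by rewrite all_rcons /= eqxx gsK.
Qed.

Lemma P_groups i : exists gs, [/\ filtration (P i) (map snd gs),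
  List.Forall good gs, sorted gt gs & all (fun b : 'I_n * A => (i <= b.1)%N) gs].
Proof.
elim/Filt_ind: (strat i) => [X zX|X' X _ _ [gs [fX' ggs sgs igs]] [j ij ->] f g fg].
  by exists [::]; split=> //; apply: filtration_nil.
have [gs' [fX ggs' sgs' ags']] := insert_group fg fX' ggs sgs.
exists gs'; split=> //; apply: sub_all ags' => c /orP[/eqP-> //|].
by rewrite -(all_map fst (fun l : 'I_n => (i <= l)%N)) in igs; apply: (allP igs).
Qed.

End Stratified.

End ProperStandardObjects.

(** * The weighted stability function *)

Lemma In_map T U (f : T -> U) (s : seq T) (y : U) :
  List.In y (map f s) -> exists2 x, List.In x s & y = f x.
Proof.
elim: s => //= x s IHs [<-|/IHs[w ws ->]]; first by exists x; [left|].
by exists w; [right|].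
Qed.

Section WeightedCharge.
Context (R : realType) (A : abelian_category) (n : nat) (S : 'I_n -> A).
Hypotheses (lenA : length_category A) (repS : simple_representatives S).
Implicit Types (M : nat) (X Y : A).

(** Minus the real part of the charge of [X], whose imaginary part is the length; phase comparisons
    become inequalities in [nat]. *)
Definition weight M X : nat := \sum_(k < n) mult X (S k) * M ^ k.

Lemma weight_charge M : exists Z : {additive K0 A -> R[i]},
  stability_function Z /\ forall X Y, ~ is_zero X -> ~ is_zero Y ->
    (phase Z X < phase Z Y) =
    (weight M X * obj_length Y < obj_length X * weight M Y)%N.
Proof.
pose c X : R[i] := Complex (- (weight M X)%:R) (obj_length X)%:R.
have [|Z Zc] := @K0_lift A _ c.
  move=> X Y W f g fg; apply/eqP; rewrite eq_complex /= -opprD -!natrD.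
  rewrite (obj_length_ses lenA fg) eqxx andbT /weight -big_split /=.
  by apply/eqP; congr (- _%:R); apply: eq_bigr => k _; rewrite (mult_ses lenA _ fg) mulnDl.
have sZ : stability_function Z.
  move=> X nX; apply: semiclosed_upper_half_plane_Im.
  by rewrite Zc /= ltr0n; apply: obj_length_gt0.
exists Z; split=> // X Y nX nY; rewrite (phase_ltE sZ) // !Zc /cross /=.
by rewrite mulNr mulrN opprK -!natrM addrC subr_gt0 ltr_nat.
Qed.

Lemma weight_bound M X (i : nat) : (0 < M)%N ->
  (forall k : 'I_n, mult X (S k) <> 0 -> (k < i)%N)%N ->
  (weight M X * M <= obj_length X * M ^ i)%N.
Proof.
move=> M0 Xi; rewrite (obj_length_sum_mult _ lenA repS) /weight !big_distrl /=.
apply: leq_sum => k _; have [->//|/eqP/Xi ki] := eqVneq (mult X (S k)) 0%N.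
by rewrite -mulnA -expnSr leq_mul2l leq_pexp2l ?orbT.
Qed.

Lemma weight_ge M X (i : 'I_n) : (0 < mult X (S i))%N -> (M ^ i <= weight M X)%N.
Proof.
move=> Xi; rewrite /weight (bigD1 i) //=; apply: leq_trans (leq_addr _ _).
by rewrite leq_pmull.
Qed.

(** The chain is [weight M X * obj_length Y < weight M X * M <= obj_length X * M ^ i <= obj_length X
    * weight M Y]. Its first inequality is strict only for positive [weight M X], hence the case
    distinction. *)
Lemma weight_lt M X Y (i : 'I_n) :
  ~ is_zero X -> (forall k : 'I_n, mult X (S k) <> 0 -> (k < i)%N)%N ->
  (0 < mult Y (S i))%N -> (obj_length Y < M)%N ->
  (weight M X * obj_length Y < obj_length X * weight M Y)%N.
Proof.
move=> nX Xi Yi YM; have M0 : (0 < M)%N by apply: leq_trans YM.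
have lX := obj_length_gt0 lenA nX; have wY := weight_ge M Yi.
have bX := weight_bound M0 Xi.
have bXY : (obj_length X * M ^ i <= obj_length X * weight M Y)%N by rewrite leq_mul2l wY orbT.
have [->|wX] := posnP (weight M X).
  by rewrite mul0n muln_gt0 lX (leq_trans _ wY) // expn_gt0 M0.
by apply: leq_trans (leq_trans bX bXY); rewrite ltn_mul2l wX.
Qed.

End WeightedCharge.

Theorem theorem5p2 (R : realType) (A : abelian_category)
    (n : nat) (S P D E : 'I_n -> A)
    (A_length : length_category A)
    (A_proj : enough_projectives A)
    (S_simples : simple_representatives S)
    (P_cover : forall i, projective_cover (P i) (S i))
    (D_standard : forall i, standard_object S P i (D i))
    (E_proper_standard : forall i, proper_standard_object S D i (E i)) :
  properly_stratified P E <->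
  exists Z : {additive K0 A -> R[i]},
    [/\ stability_function Z,
        forall i, stable Z (E i),
        forall i j : 'I_n, (i < j)%N -> phase Z (E i) < phase Z (E j)
      & forall (i : 'I_n) (F : A), hn_factor Z (P i) F ->
          exists2 j : 'I_n, (i <= j)%N & Filt (fun X => X = E j) F].
Proof.
split=> [strat|[Z [sZ _ _ hnP]] i]; last first.
  have [Fs hFs] := hn_exists sZ A_length S_simples (P i).
  have [fP _ _] := hFs; apply: Filt_filtration fP _.
  apply/List.Forall_forall => F FFs.
  have [|j ij] := hnP i F; first by exists Fs.
  by apply: Filt_sub => X ->; exists j.
have nE := E_neq0 A_length E_proper_standard.
have mE := mult_ES E_proper_standard.
have mE_gt := mult_ES_gt A_length S_simples D_standard E_proper_standard.
(* The successor provides the strict bound on lengths that [weight_lt] requires. *)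
pose M := (\max_j obj_length (E j)).+1.
have ltM j : (obj_length (E j) < M)%N by rewrite ltnS leq_bigmax.
have [Z [sZ phZ]] := weight_charge R S A_length M.
have ph_lt X (i : 'I_n) : ~ is_zero X -> (forall k : 'I_n, mult X (S k) <> 0%N -> (k < i)%N) ->
    phase Z X < phase Z (E i).
  by move=> nX Xi; rewrite phZ //; apply: weight_lt Xi _ _; rewrite ?mE.
have supp_le (i k : 'I_n) : mult (E i) (S k) <> 0%N -> (k <= i)%N.
  by move=> Eik; rewrite leqNgt; apply/negP => /mE_gt.
(* A proper subobject lies in the kernel of the map from [E i] to its top [S i]. As [S i] occurs
   only once in [E i], only simples of index below [i] occur in the subobject, and [ph_lt]
   applies. *)
have stE i : stable Z (E i).
  split=> // Y m mm nY niY; apply: ph_lt => // k Yk.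
  have [t et] := E_top A_length S_simples P_cover D_standard E_proper_standard i.
  have tm := essential_epi_proper_sub (simpleS S_simples i) et mm niY.
  have [K [u ut]] := ses_of_epi (proj1 et).
  have [v uv] := ses_lift ut tm.
  have Yi : mult Y (S i) = 0%N.
    have mv : is_mono v by apply: (@mono_of_comp _ _ _ _ u); rewrite uv.
    apply/eqP; rewrite -leqn0 (leq_trans (mult_sub A_length (S i) mv)) //.
    have := mult_ses A_length (S i) ut.
    by rewrite mE (mult_SS A_length S_simples) eqxx addn1 => -[<-].
  rewrite ltn_neqAle; apply/andP; split.
    by apply/eqP => /val_inj ki; apply: Yk; rewrite ki.
  apply: supp_le => Ek; apply: Yk; apply/eqP.
  by rewrite -leqn0 -Ek; apply: (mult_sub A_length _ mm).
exists Z; split=> // [i j ij|i F [Fs hFs FFs]].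
  by apply: ph_lt => // k /supp_le ki; apply: leq_ltn_trans ij.
have [gs [fP ggs sgs igs]] := P_groups A_length S_simples P_cover D_standard
  E_proper_standard strat i.
have hgs : harder_narasimhan Z (P i) (map snd gs).
  have ssE j := stable_semistable (stE j).
  split=> //.
    elim: ggs => {fP sgs igs}[|[j X] gs' [nX FX] _ IH] /=; constructor=> //.
    by have [] := Filt_semistable sZ (ssE j) FX nX.
  rewrite sorted_map; move: sgs ggs; case: gs {fP igs} => //= b gs.
  elim: gs b => //= c gs IH b /andP[cb sgs] Fgs.
  inversion Fgs as [|b' gs' gb ggs]; subst b' gs'; rewrite IH // andbT.
  inversion ggs as [|c' gs' gc _]; subst c' gs'.
  rewrite (proj2 (Filt_semistable sZ (ssE b.1) gb.2 gb.1)).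
  rewrite (proj2 (Filt_semistable sZ (ssE c.1) gc.2 gc.1)).
  by apply: ph_lt => // k /supp_le ki; apply: leq_ltn_trans cb.
(* The given factor may come from any Harder-Narasimhan filtration; uniqueness identifies it with
   one of the sorted groups. *)
have [G Ggs FG] := hn_unique sZ hFs hgs FFs.
have [b bgs eG] := In_map Ggs; subst G.
have [_ Fb] := proj1 (List.Forall_forall _ _) ggs b bgs.
exists b.1; last by apply: Filt_iso Fb; apply: isomorphic_sym.
by move: igs => /Forall_allP igs; exact: proj1 (List.Forall_forall _ _) igs b bgs.
Qed.
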